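(* Let $\Omega$ be a bounded convex domain in $\mathbf{R}^n$ ($n\ge1$), $D:=\Omega\times(0,\infty)$, let $f=f(x,t,v,\theta)$ be a nonnegative continuous function in $D\times\mathbf{R}\times\mathbf{R}^n$, and let $0<p<1$ and $1/2\le\alpha\le1$. Let $u\in C^{2,1}(D)\cap C(\overline D)$ satisfy $$\partial_t u=\Delta u+f(x,t,u,\nabla u)\quad\text{in } D,\qquad u=0\quad\text{on }\partial D.$$ Assume the following conditions: (i) $\partial_t u\ge0$ in $D$; (ii) for all $x\in\overline\Omega$ and $y\in\Omega$, $$\lim_{\rho\to0+}\frac{u\left(x+\nu\rho,\rho^{1/\alpha}\right)^p}{\rho}=\infty,\qquad\text{where }\nu:=\frac{y-x}{|y-x|}\text{ if }x\ne y,\quad \nu:=0\text{ if }x=y;$$ (iii) for every fixed $\theta\in\mathbf{R}^n$, the function $$g_{\alpha,p,\theta}(x,t,v):=v^{3-1/p}f\left(x,t^{1/\alpha},v^{1/p},v^{1/p-1}\theta\right)$$ is concave with respect to $(x,t,v)\in D\times(0,\infty)$. Then, for any $\lambda\in\Lambda_{n+1}$, the $\alpha$-parabolically $p$-concave $\lambda$-envelope $u_{\alpha,p,\lambda}$ of $u$ is a viscosity subsolution of $\partial_t u=\Delta u+f(x,t,u,\nabla u)$ in $D$ such that $u_{\alpha,p,\lambda}=0$ on $\partial D$. In addition, if the comparison principle (WCP) holds for this equation, then $u=u_{\alpha,p}$ in $\overline D$ and $u$ is $\alpha$-parabolically $p$-concave in $\overline D$.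
   Context: $\Lambda_m:=\{\lambda=(\lambda_1,\dots,\lambda_m)\in(0,1)^m:\sum_{i=1}^m\lambda_i=1\}$ for $m\ge2$. For $a\in[0,\infty)^m$, $\lambda\in\Lambda_m$ and $p\in(0,\infty)$, $\mathbf{M}_p(a;\lambda):=[\lambda_1a_1^p+\cdots+\lambda_ma_m^p]^{1/p}$. For $a,b\ge0$, $\lambda\in(0,1)$, $p\in(0,\infty)$, $M_p(a,b;\lambda):=[(1-\lambda)a^p+\lambda b^p]^{1/p}$. $\partial D$ is the boundary of $D$ in $\mathbf{R}^{n+1}$, i.e. $(\partial\Omega\times[0,\infty))\cup(\Omega\times\{0\})$, so the boundary condition includes zero initial data. $\alpha$-parabolic $p$-concavity: a nonnegative function $v$ on $\overline D=\overline\Omega\times[0,\infty)$ is $\alpha$-parabolically $p$-concave in $\overline D$ if $v((1-\lambda)x_1+\lambda x_2,M_\alpha(t_1,t_2;\lambda))\ge M_p(v(x_1,t_1),v(x_2,t_2);\lambda)$ for all $(x_1,t_1),(x_2,t_2)\in\overline D$ and $\lambda\in(0,1)$. Envelopes: for a nonnegative function $u$ on $\overline D$ and $\lambda=(\lambda_1,\dots,\lambda_{n+1})\in\Lambda_{n+1}$, the $\alpha$-parabolically $p$-concave $\lambda$-envelope of $u$ is, for $(x,t)\in\overline D$, $$u_{\alpha,p,\lambda}(x,t):=\sup\Big\{\mathbf{M}_p(u(y_1,\tau_1),\dots,u(y_{n+1},\tau_{n+1});\lambda):\{(y_i,\tau_i)\}_{i=1}^{n+1}\subset\overline D,\ x=\sum_{i=1}^{n+1}\lambda_iy_i,\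 t=\mathbf{M}_\alpha((\tau_1,\dots,\tau_{n+1});\lambda)\Big\},$$ and $u_{\alpha,p}(x,t):=\sup_{\lambda\in\Lambda_{n+1}}u_{\alpha,p,\lambda}(x,t)$. Viscosity subsolution: an upper semicontinuous function $w$ in $D$ is a viscosity subsolution of $\partial_tu=\Delta u+f(x,t,u,\nabla u)$ if for any $(x_0,t_0)\in D$ the inequality $\partial_t\phi\le\Delta\phi+f(x,t,\phi,\nabla\phi)$ holds at $(x,t)=(x_0,t_0)$ for all $\phi\in C^{2,1}(D)$ with $\phi(x_0,t_0)=w(x_0,t_0)$ and $\phi\ge w$ in a neighborhood of $(x_0,t_0)$. (WCP) is the following property of the equation: whenever $u\in C(\overline D)\cap C^{2,1}(D)$ is a nonnegative classical solution and $v\in C(\overline D)$ is a nonnegative viscosity subsolution of the equation with $u\ge v$ on $\partial D$, then $u\ge v$ in $\overline D$. The expression in (ii) is well defined for all sufficiently small $\rho>0$ since $\Omega$ is convex. *)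

(* Defs.v *)
From HB Require Import structures.
From mathcomp Require Import all_boot all_order all_algebra.
From mathcomp Require Import all_classical all_reals all_analysis.

Set Implicit Arguments.
Unset Strict Implicit.
Unset Printing Implicit Defensive.

Import Order.TTheory GRing.Theory Num.Theory.
Import numFieldNormedType.Exports.

Local Open Scope classical_set_scope.
Local Open Scope ring_scope.

(* A space-time point is z : 'rV[R]_n * R, with z.1 the space variable and z.2
   the time variable.  Functions on D or on its closure are total functions on
   'rV[R]_n * R, of which only the values on the relevant set matter. *)

Section Domains.
Context {R : realType} {n : nat}.
Implicit Type Omega : set 'rV[R]_n.

Definition domain Omega := [/\ open Omega, Omega !=set0 & connected Omega].

Definition cylinder Omega : set ('rV[R]_n * R) :=
  Omega `*` [set t | 0 < t].

Definition closed_cylinder Omega : set ('rV[R]_n * R) :=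
  closure Omega `*` [set t | 0 <= t].

(* The bottom of the cylinder is included; [Omega°] is the interior. *)
Definition cylinder_boundary Omega : set ('rV[R]_n * R) :=
  ((closure Omega `\` Omega°) `*` [set t | 0 <= t]) `|`
  (Omega `*` [set 0]).

(* The library norm on row vectors is the sup norm. *)
Definition euclidean_norm (x : 'rV[R]_n) : R :=
  Num.sqrt (\sum_(i < n) x 0 i ^+ 2).

Definition unit_direction (x y : 'rV[R]_n) : 'rV[R]_n :=
  if x == y then 0 else (euclidean_norm (y - x))^-1 *: (y - x).

End Domains.

Section Derivatives.
Context {R : realType} {n : nat}.
Implicit Types (u : 'rV[R]_n * R -> R) (z : 'rV[R]_n * R).

Definition space_dir (i : 'I_n) : 'rV[R]_n * R := (delta_mx 0 i, 0).
Definition time_dir : 'rV[R]_n * R := (0, 1).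

Definition dx (i : 'I_n) u z : R := 'D_(space_dir i) u z.
Definition dt u z : R := 'D_time_dir u z.

Definition gradient u z : 'rV[R]_n := \row_i dx i u z.
Definition laplacian u z : R := \sum_(i < n) dx i (dx i u) z.

Definition C21 (D : set ('rV[R]_n * R)) u :=
  [/\ {within D, continuous u},
      (forall z, D z -> derivable u z time_dir) /\
        {within D, continuous (dt u)},
      (forall i, (forall z, D z -> derivable u z (space_dir i)) /\
        {within D, continuous (dx i u)}) &
      (forall i j, (forall z, D z -> derivable (dx i u) z (space_dir j)) /\
        {within D, continuous (dx j (dx i u))})].

End Derivatives.

Section Equation.
Context {R : realType} {n : nat}.
Variable Omega : set 'rV[R]_n.
(* The argument of f is (z, v, theta), where z = (x, t). *)
Variable f : ('rV[R]_n * R) * R * 'rV[R]_n -> R.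
Implicit Types u v w phi : 'rV[R]_n * R -> R.

Let D := cylinder Omega.
Let Dbar := closed_cylinder Omega.

Definition rhs u (z : 'rV[R]_n * R) : R :=
  laplacian u z + f (z, u z, gradient u z).

Definition classical_solution u :=
  [/\ C21 D u, {within Dbar, continuous u} &
      forall z, D z -> dt u z = rhs u z].

Definition upper_semicontinuous_in (A : set ('rV[R]_n * R)) w :=
  forall z, A z -> forall a, w z < a -> \forall y \near z, w y < a.

Definition viscosity_subsolution w :=
  upper_semicontinuous_in D w /\
  forall z phi, D z -> C21 D phi -> phi z = w z ->
    (\forall y \near z, w y <= phi y) -> dt phi z <= rhs phi z.

Definition weak_comparison_principle :=
  forall u v,
    classical_solution u -> (forall z, Dbar z -> 0 <= u z) ->
    {within Dbar, continuous v} -> (forall z, Dbar z -> 0 <= v z) ->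
    viscosity_subsolution v ->
    (forall z, cylinder_boundary Omega z -> v z <= u z) ->
    forall z, Dbar z -> v z <= u z.

End Equation.

Section Means.
Context {R : realType}.

Definition open_simplex (m : nat) : set ('I_m -> R) :=
  [set lambda | (forall i, 0 < lambda i < 1) /\ \sum_(i < m) lambda i = 1].

Definition power_mean (m : nat) (p : R) (lambda a : 'I_m -> R) : R :=
  (\sum_(i < m) lambda i * a i `^ p) `^ p^-1.

Definition power_mean2 (p l a b : R) : R :=
  ((1 - l) * a `^ p + l * b `^ p) `^ p^-1.

End Means.

Arguments open_simplex {R} m _.

Section Concavity.
Context {R : realType} {n : nat}.
Variable Omega : set 'rV[R]_n.
Variables alpha p : R.
Implicit Types (u : 'rV[R]_n * R -> R) (z : 'rV[R]_n * R).

Let Dbar := closed_cylinder Omega.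

Definition parabolically_concave u :=
  (forall z, Dbar z -> 0 <= u z) /\
  forall z1 z2 (l : R), Dbar z1 -> Dbar z2 -> 0 < l < 1 ->
    power_mean2 p l (u z1) (u z2) <=
      u ((1 - l) *: z1.1 + l *: z2.1, power_mean2 alpha l z1.2 z2.2).

Definition envelope_points (lambda : 'I_n.+1 -> R) z :
    set ('I_n.+1 -> 'rV[R]_n * R) :=
  [set Y | [/\ forall i, Dbar (Y i),
               z.1 = \sum_(i < n.+1) lambda i *: (Y i).1 &
               z.2 = power_mean alpha lambda (fun i => (Y i).2)]].

Definition lambda_envelope u (lambda : 'I_n.+1 -> R) z : \bar R :=
  ereal_sup [set (power_mean p lambda (fun i => u (Y i)))%:E
            | Y in envelope_points lambda z].

Definition envelope u z : \bar R :=
  ereal_sup [set lambda_envelope u lambda z | lambda in open_simplex n.+1].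

End Concavity.

Definition transformed_source {R : realType} {n : nat}
    (f : ('rV[R]_n * R) * R * 'rV[R]_n -> R) (alpha p : R) (theta : 'rV[R]_n)
    (w : ('rV[R]_n * R) * R) : R :=
  let: ((x, t), v) := w in
  v `^ (3 - p^-1) *
  f ((x, t `^ alpha^-1), v `^ p^-1, v `^ (p^-1 - 1) *: theta).

Definition concave_on {R : realType} {E : lmodType R} (A : set E)
    (g : E -> R) := @convex_function R E A (fun x => - g x).

(* Main.v *)
Require Import Defs.
From HB Require Import structures.
From mathcomp Require Import all_boot all_order all_algebra.
From mathcomp Require Import all_classical all_reals all_analysis.
From mathcomp Require Import ring lra.

Set Implicit Arguments.
Unset Strict Implicit.
Unset Printing Implicit Defensive.

Import Order.TTheory GRing.Theory Num.Theory.
Import numFieldNormedType.Exports.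

Local Open Scope classical_set_scope.
Local Open Scope ring_scope.

(* In the variables (x, s) = (x, t^alpha) and V = u^p, the lambda-envelope is the
   supremal convolution of V with weights lambda.  By compactness it is attained,
   and it is upper semicontinuous; by the growth condition (ii) and the
   monotonicity of u in time, at an interior point every maximizer Y_1, ..., Y_m
   has all its components in the open cylinder.

   If phi touches the envelope from above there, then phi^p at the average of
   perturbed points dominates the average of the values of V at these points.
   Perturbing one component at a time shows that the first derivatives of phi^p
   and of V agree; perturbing Y_i by (V(Y_i) / phi^p) h e_k and summing over k
   compares the Laplacians.  Inserting the equation for u, the gradient terms
   cancel, the source terms are handled by the concavity hypothesis (iii), and
   the time derivatives by the joint convexity of U^2 s^(1 - 1/alpha), which uses
   alpha >= 1/2.  Interior maximizers can be translated, so the envelope is also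
   lower semicontinuous and the comparison principle gives u = envelope. *)

(** * Convex combinations *)

Section Convexity.
Context {R : realType}.

(** Why the gradient terms cancel, and where the exponents in (iii) come from. Put U_i = V(Y_i), P
    for their weighted average, a = v^(p-1) with v the value of u or phi at the point concerned, s
    for the warped time and g = 1/alpha - 1. First-order contact says that a grad v and a v_t s^g
    take common values G and kappa at every Y_i and at the contact point. With displacements c_i =
    U_i / P the quadratic terms (p-1) v^(p-2) |c_i grad v|^2 become (p-1) |G|^2 U_i / P^2. They are
    linear in U_i, so they average exactly to the corresponding term for phi. The price is a factor
    c_i^2 elsewhere. The source enters as U_i^2 a_i f = v^(3p-1) f, that is V^(3-1/p) f, the
    function of (iii) with theta = G. The time derivatives enter as kappa c_i^2 s_i^(-g) with kappa
    nonnegative by (i), which calls for the convexity of U^2 s^(-g) for g in [0,1]. All this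
    differentiates p-th powers of positive values at interior points, whereas u vanishes on the
    boundary; hence the prior work on the location of maximizers. *)

Lemma convex_setP (M : lmodType R) (A : set M) (x y : M) (a b : R) :
  convex_set A -> A x -> A y -> 0 <= a -> 0 <= b -> a + b = 1 ->
  A (a *: x + b *: y).
Proof.
move=> cA Ax Ay a0 b0 ab.
have a01 : (0 <= a <= 1)%R by rewrite a0 /= -ab lerDl.
have := cA x y (Itv01 a0 (andP a01).2) (mem_set Ax) (mem_set Ay).
rewrite inE /conv /=; suff -> : b = 1 - a by [].
by rewrite -ab addrC addKr.
Qed.

Lemma convex_setP_inv (M : lmodType R) (A : set M) :
  (forall x y (a b : R), A x -> A y -> 0 <= a -> 0 <= b -> a + b = 1 ->
    A (a *: x + b *: y)) -> convex_set A.
Proof.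
move=> cA x y l; rewrite !inE => Ax Ay.
by apply: cA => //=; rewrite ?subr_ge0 // addrC subrK.
Qed.

Lemma convex_set_sum (M : lmodType R) (A : set M) (m : nat)
    (w : 'I_m -> R) (x : 'I_m -> M) :
  convex_set A -> (forall i, 0 <= w i) -> \sum_i w i = 1 ->
  (forall i, A (x i)) -> A (\sum_i w i *: x i).
Proof.
move=> cA; elim: m w x => [|m IH] w x w0 w1 Ax.
  by move: w1; rewrite big_ord0 => /eqP; rewrite eq_sym oner_eq0.
move: w1; rewrite !big_ord_recl => w1.
(* A first weight equal to 1 is set apart because the other weights get renormalised by their
   sum. *)
have [w01|w01] := eqVneq (w ord0) 1.
  have s0 : \sum_(i < m) w (lift ord0 i) = 0.
    by apply: (addrI (w ord0)); rewrite w1 w01 addr0.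
  rewrite big1 ?w01 ?scale1r ?addr0 // => i _.
  rewrite (psumr_eq0P _ s0) ?scale0r // => j _.
set s := \sum_(i < m) w (lift ord0 i) in w1 *.
have s0 : 0 < s.
  rewrite lt_neqAle sumr_ge0 ?andbT // eq_sym.
  by apply: contraNneq w01 => s0; rewrite -w1 s0 addr0.
have -> : \sum_(i < m) w (lift ord0 i) *: x (lift ord0 i) =
    s *: \sum_(i < m) (w (lift ord0 i) / s) *: x (lift ord0 i).
  rewrite scaler_sumr; apply: eq_bigr => i _.
  by rewrite scalerA mulrCA divff ?mulr1 // gt_eqF.
apply: convex_setP => //; last exact: ltW.
apply: IH => //; first by move=> i; rewrite divr_ge0 // ltW.
by rewrite -mulr_suml divff // gt_eqF.
Qed.

(** Jensen's inequality read off the hypograph [H]: it is convex and contains the points (x_i,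
    g(x_i)), hence their average. *)
Lemma concave_on_sum (M : lmodType R) (A : set M) (g : M -> R) (m : nat)
    (w : 'I_m -> R) (x : 'I_m -> M) :
  convex_set A -> concave_on A g -> (forall i, 0 <= w i) -> \sum_i w i = 1 ->
  (forall i, A (x i)) -> \sum_i w i * g (x i) <= g (\sum_i w i *: x i).
Proof.
move=> cA cg w0 w1 Ax.
pose H : set (M * R) := [set z | A z.1 /\ z.2 <= g z.1].
have cH : convex_set H.
  apply: convex_setP_inv => -[a r] [b s] c d [/= Aa ra] [/= Ab sb] c0 d0 cd.
  split => /=; first exact: convex_setP.
  have c01 : (0 <= c <= 1)%R by rewrite c0 /= -cd lerDl.
  have := cg (Itv01 c0 (andP c01).2) a b (mem_set Aa) (mem_set Ab).
  rewrite /conv /= /conv /=.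
  have -> : unstable.onem c = d by rewrite /unstable.onem -cd addrC addKr.
  rewrite /GRing.scale /= !mulrN -opprD lerN2; apply: le_trans.
  exact: lerD (ler_wpM2l c0 ra) (ler_wpM2l d0 sb).
have := @convex_set_sum _ H m w (fun i => (x i, g (x i))) cH w0 w1 (fun i => conj (Ax i) (lexx _)).
by case; rewrite (raddf_sum (@fst M R)) (raddf_sum (@snd M R)).
Qed.

Section Normed.
Variable (M : normedModType R) (A : set M).
Hypothesis cA : convex_set A.

Lemma convex_closure : convex_set (closure A).
Proof.
apply: convex_setP_inv => x y a b Ax Ay a0 b0 ab.
have h : continuous (fun z : M * M => a *: z.1 + b *: z.2).
  move=> z; apply: cvgD; apply: cvgZl_tmp; [exact: cvg_fst|exact: cvg_snd].
move=> B /(h (x, y)) [[P Q] [/= Px Qy]] PQ.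
have [x' [Ax' Px']] := Ax _ Px; have [y' [Ay' Qy']] := Ay _ Qy.
exists (a *: x' + b *: y'); split; first exact: convex_setP.
exact: (PQ (x', y')).
Qed.

Lemma convex_closure_open (x y : M) (a b : R) : open A -> closure A x -> A y ->
  0 <= a -> 0 < b -> a + b = 1 -> A (a *: x + b *: y).
Proof.
move=> oA Ax Ay a0 b0 ab.
(* [a x + b y = a x' + b (h x')] for every x'; when x' in A is close to x,
   the point h x' is close to y, hence in A. *)
pose h x' := y + (a / b) *: (x - x').
have hc : continuous h.
  move=> z; apply: cvgD; first exact: cvg_cst.
  by apply: cvgZl_tmp; apply: cvgB; [exact: cvg_cst|exact: cvg_id].
have hx : h x = y by rewrite /h subrr scaler0 addr0.
have /Ax [x' [Ax' Ahx']] : nbhs x (h @^-1` A).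
  by apply: hc; rewrite hx; exact: open_nbhs_nbhs.
have -> : a *: x + b *: y = a *: x' + b *: h x'.
  rewrite /h scalerDr scalerA mulrCA divff ?mulr1 ?gt_eqF // scalerBr.
  by rewrite [RHS]addrC -addrA subrK addrC.
by apply: convex_setP => //; exact: ltW.
Qed.

(** The points other than [x j] are merged into a single point of the closure, of weight 1 - w_j.
    Used in contrapositive form: an average on the boundary of a convex open set forces every point
    of the combination out of the set. *)
Lemma convex_closure_open_sum (m : nat) (w : 'I_m -> R) (x : 'I_m -> M) j :
  open A -> (forall i, 0 <= w i) -> \sum_i w i = 1 ->
  (forall i, closure A (x i)) -> A (x j) -> 0 < w j -> A (\sum_i w i *: x i).
Proof.
move=> oA w0 w1 Ax Aj wj.
rewrite (bigD1 j) //= addrC.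
have [w1j|w1j] := eqVneq (w j) 1.
  have s0 : \sum_(i < m | i != j) w i = 0.
    by move: w1; rewrite (bigD1 j) //= w1j -[RHS]addr0 => /addrI.
  rewrite big1 ?w1j ?add0r ?scale1r // => i ij.
  by rewrite (psumr_eq0P _ s0) ?scale0r // => k _.
have s0 : 0 < 1 - w j.
  rewrite subr_gt0 lt_neqAle w1j /= -w1 (bigD1 j) //= lerDl.
  exact: sumr_ge0.
have -> : \sum_(i < m | i != j) w i *: x i =
    (1 - w j) *: \sum_i (if i == j then 0 else w i / (1 - w j)) *: x i.
  rewrite [in RHS](bigD1 j) //= eqxx scale0r add0r scaler_sumr.
  apply: eq_bigr => i /negbTE ->.
  by rewrite scalerA mulrCA divff ?mulr1 // gt_eqF.
apply: convex_closure_open => //; [|exact: ltW|by rewrite subrK].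
apply: convex_set_sum => //; first exact: convex_closure.
  by move=> i; case: ifP => // _; rewrite divr_ge0 // ltW.
rewrite (bigD1 j) //= eqxx add0r.
rewrite (eq_bigr (fun i => w i / (1 - w j))) => [|i /negbTE -> //].
have sE : \sum_(i < m | i != j) w i = 1 - w j.
  by rewrite -w1 [in RHS](bigD1 j) //= [w j + _]addrC addrK.
by rewrite -mulr_suml sE divff // gt_eqF.
Qed.

End Normed.
End Convexity.

(** * One-variable calculus and powers *)

Section OneVariable.
Context {R : realType}.

Lemma is_derive_line (V : normedModType R) (f : V -> R) (z v : V) (h : R) :
  derivable f (z + h *: v) v ->
  is_derive h 1 (fun k => f (z + k *: v)) ('D_v f (z + h *: v)).
Proof.
move=> df; have E : (fun k : R => k^-1 *:
      (((fun k => f (z + k *: v)) \o shift h) (k *: 1) - f (z + h *: v))) =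
    (fun k : R => k^-1 *: ((f \o shift (z + h *: v)) (k *: v) - f (z + h *: v))).
  apply/funext => k /=; congr (_ *: (f _ - _)).
  by rewrite [k *: 1]mulr1 scalerDl addrCA addrC.
by split; rewrite ?/derivable ?/derive E.
Qed.

Lemma is_derive_lineZ (V : normedModType R) (f : V -> R) (z v : V) (c h : R) :
  derivable f (z + (c * h) *: v) v ->
  is_derive h 1 (fun k => f (z + (c * k) *: v)) (c * 'D_v f (z + (c * h) *: v)).
Proof.
move=> df; rewrite mulrC.
have d1 : is_derive h 1 (fun k : R => c * k) c.
  by apply: (is_derive_eq (is_deriveZ c (is_derive_id h 1))); rewrite [LHS]mulr1.
exact: (@is_derive1_comp _ (fun k => f (z + k *: v)) _ h _ _ (is_derive_line df) d1).
Qed.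

Lemma derivable_locally_lipschitz (g : R -> R) (x : R) : derivable g x 1 ->
  exists2 C, 0 <= C & \forall h \near (0 : R), `|g (x + h) - g x| <= C * `|h|.
Proof.
move=> dg; exists (`|'D_1 g x| + 1); first by rewrite addr_ge0.
have /cvgrPdist_lt /(_ 1 ltr01) := dg.
rewrite near_withinE; apply: filterS => h gh.
have [->|h0] := eqVneq h 0; first by rewrite addr0 subrr !normr0 mulr0.
have := gh h0; rewrite [h *: 1]mulr1 /= => {}gh.
rewrite -ler_pdivrMr ?normr_gt0 // -normfV -normrM mulrC [x + h]addrC.
apply: le_trans (lerD (lexx _) (ltW gh)).
set q := _^-1 * _; rewrite -{1}[q](subKr ('D_1 g x)).
exact: ler_normB.
Qed.

Lemma first_derivative_test (F F' : R -> R) :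
  (\forall h \near (0 : R), is_derive (h : R) 1 F (F' h)) ->
  (\forall h \near (0 : R), F 0 <= F h) -> F' 0 = 0.
Proof.
move=> dF mF.
have /nbhs_ballP[e /= e0 eF] :
  nbhs (0 : R) [set h : R | is_derive (h : R) 1 F (F' h) /\ F 0 <= F h] by exact: filterI.
have {}eF h : h \in `]- e, e[ -> is_derive h 1 F (F' h) /\ F 0 <= F h.
  rewrite in_itv /= => he; apply: eF; rewrite /ball /= sub0r normrN.
  by rewrite ltr_norml.
have e0' : 0 \in `]- e, e[ by rewrite in_itv /= e0 oppr_lt0 e0.
have D0 : is_derive (0 : R) 1 F 0.
  apply: (@derive1_at_min _ _ (- e) e) => [|t /eF[]||t /eF[]] //.
  by rewrite ge0_cp ?ltW.
have [D1 _] := eF 0 e0'.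
by rewrite -(@derive_val _ _ _ _ _ _ _ D1) (@derive_val _ _ _ _ _ _ _ D0).
Qed.

(** Differentiability of [F'] at 0 alone suffices: were [F2] negative, [F'] would be negative just
    to the right of 0, and the mean value theorem would give F(h) < F(0). *)
Lemma second_derivative_test (F F' : R -> R) (F2 : R) :
  (\forall h \near (0 : R), is_derive (h : R) 1 F (F' h)) -> is_derive (0 : R) 1 F' F2 ->
  (\forall h \near (0 : R), F 0 <= F h) -> F' 0 = 0 /\ 0 <= F2.
Proof.
move=> dF dF' mF; have F'0 := first_derivative_test dF mF.
have /nbhs_ballP[e /= e0 eF] :
  nbhs (0 : R) [set h : R | is_derive (h : R) 1 F (F' h) /\ F 0 <= F h] by exact: filterI.
have {}eF h : h \in `]- e, e[ -> is_derive h 1 F (F' h) /\ F 0 <= F h.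
  rewrite in_itv /= => he; apply: eF; rewrite /ball /= sub0r normrN.
  by rewrite ltr_norml.
split=> //; rewrite leNgt; apply/negP => F20.
have /cvgrPdist_lt /(_ (- F2)) : (fun h => h^-1 *: ((F' \o shift 0) (h *: 1) - F' 0))
    h @[h --> 0^'] --> F2.
  by rewrite -(@derive_val _ _ _ _ _ _ _ dF'); exact: (@ex_derive _ _ _ _ _ _ _ dF').
rewrite oppr_gt0 => /(_ F20); rewrite near_withinE => /nbhs_ballP[d /= d0 dF2].
have [h [h0 hd he]] : exists h, [/\ 0 < h, h < d & h < e].
  have m0 : 0 < Num.min d e by rewrite lt_min d0.
  exists (Num.min d e / 2); rewrite divr_gt0 //.
  have : Num.min d e / 2 < Num.min d e by rewrite ltr_pdivrMr // ltr_pMr // ltr1n.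
  by rewrite lt_min => /andP[-> ->].
have h_itv t : 0 <= t <= h -> t \in `]- e, e[.
  move=> /andP[t0 th]; rewrite in_itv /= (le_lt_trans th he) andbT.
  by rewrite (lt_le_trans _ t0) // oppr_lt0.
have [||c ch] := @MVT _ F F' 0 h h0.
- by move=> t; rewrite in_itv /= => /andP[t0 th]; apply: (eF t _).1;
    apply: h_itv; rewrite !ltW.
- apply: derivable_within_continuous => t; rewrite in_itv /= => th.
  exact: (@ex_derive _ _ _ _ _ _ _ (eF t (h_itv _ th)).1).
rewrite subr0 => Fh.
have : F 0 <= F h by apply: (eF h _).2; apply: h_itv; rewrite lexx ltW.
rewrite -subr_ge0 Fh pmulr_lge0 // => F'c.
move: ch; rewrite in_itv /= => /andP[c0 ch].
have := dF2 c; rewrite /ball /= sub0r normrN gtr0_norm // => /(_ (lt_trans ch hd)).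
rewrite gt_eqF // => /(_ isT); rewrite F'0 subr0 /= addr0 [c *: 1]mulr1.
have : 0 <= c^-1 *: F' c by rewrite mulr_ge0 // invr_ge0 ltW.
by rewrite ltr_norml; lra.
Qed.

End OneVariable.

Section Powers.
Context {R : realType}.

Lemma powRK (b q : R) : q != 0 -> 0 <= b -> (b `^ q) `^ q^-1 = b.
Proof. by move=> q0 b0; rewrite -powRrM mulfV // powRr1. Qed.

Lemma powRVK (b q : R) : q != 0 -> 0 <= b -> (b `^ q^-1) `^ q = b.
Proof. by move=> q0 b0; rewrite -powRrM mulVf // powRr1. Qed.

Lemma ler_powRl (r a b : R) : 0 <= r -> 0 <= a -> a <= b ->
  a `^ r <= b `^ r.
Proof.
by move=> r0 a0 ab; apply: ge0_ler_powR; rewrite // nnegrE // (le_trans a0).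
Qed.

(* [powR] is 1 on negative numbers: the absolute value makes it continuous. *)
Lemma continuous_norm_powR (a : R) : 0 < a -> continuous (fun x : R => `|x| `^ a).
Proof.
move=> a0 x; have [->|x0] := eqVneq x 0.
  rewrite /continuous_at normr0 powR0 ?gt_eqF //.
  apply/cvgrPdist_lt => e e0.
  have d0 : 0 < e `^ a^-1 by rewrite powR_gt0.
  apply/nbhs_ballP; exists (e `^ a^-1) => //= y; rewrite /ball /= !sub0r !normrN => ye.
  rewrite (ger0_norm (powR_ge0 _ _)).
  have -> : e = (e `^ a^-1) `^ a by rewrite -powRrM mulVf ?gt_eqF // powRr1 // ltW.
  by rewrite gt0_ltr_powR // nnegrE ?powR_ge0.
have h : {for `|x|, continuous (fun y : R => y `^ a)}.
  apply: differentiable_continuous; apply/derivable1_diffP.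
  by apply: derivable_powR; rewrite in_itv /= andbT normr_gt0.
exact: (continuous_comp (@norm_continuous _ R x) h).
Qed.

Lemma is_derive_powR_comp (g : R -> R) (dg h r : R) : 0 < g h ->
  is_derive h 1 g dg ->
  is_derive h 1 (fun k => g k `^ r) (r * g h `^ (r - 1) * dg).
Proof.
by move=> g0 dg1; exact: (@is_derive1_comp _ (fun x => x `^ r) g h _ _ (@is_derive1_powR R r _ g0) dg1).
Qed.

Lemma is_derive_powR_comp2 (g dg : R -> R) (ddg h r : R) : 0 < g h ->
  is_derive h 1 g (dg h) -> is_derive h 1 dg ddg ->
  is_derive h 1 (fun k => r * g k `^ (r - 1) * dg k)
    (r * (g h `^ (r - 1) * ddg + (r - 1) * g h `^ (r - 1 - 1) * dg h ^+ 2)).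
Proof.
move=> g0 d1 d2.
have d3 := is_deriveZ r (is_deriveM (is_derive_powR_comp (r - 1) g0 d1) d2).
have E : r \*: ((fun k : R => g k `^ (r - 1)) * dg) =
    (fun k => r * g k `^ (r - 1) * dg k) by apply/funext => k; rewrite -mulrA.
rewrite E in d3; apply: is_derive_eq d3 _; rewrite /GRing.scale /=; ring.
Qed.

(** Convexity of [expR] between [ln r] and 0, where its values are r and 1. *)
Lemma powR_le_bernoulli (g r : R) : 0 <= g <= 1 -> 0 < r ->
  r `^ g <= 1 + g * (r - 1).
Proof.
move=> /andP[g0 g1] r0.
have := @convex_expR R (Itv01 g0 g1) (ln r) 0.
rewrite /conv /= /conv /= /unstable.onem /GRing.scale /= expR0 lnK ?posrE // mulr0 addr0.
by rewrite /powR gt_eqF // => /le_trans; apply; lra.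
Qed.

Lemma weighted_sum_gt0 (m : nat) (w s : 'I_m -> R) :
  (forall i, 0 <= w i) -> \sum_i w i = 1 -> (forall i, 0 < s i) ->
  0 < \sum_i w i * s i.
Proof.
move=> w0 w1 s0; have ws0 i : 0 <= w i * s i by rewrite mulr_ge0 // ltW.
rewrite lt_neqAle eq_sym sumr_ge0 // andbT; apply/eqP => S0.
suff : \sum_i w i = 0 by rewrite w1 => /eqP; rewrite oner_eq0.
rewrite big1 // => i _.
have /eqP := psumr_eq0P (fun i _ => ws0 i) S0 (i := i) isT.
by rewrite mulf_eq0 (gt_eqF (s0 i)) orbF => /eqP.
Qed.

(** The tangent of the concave power at the average S, namely S^g (1 + g (s/S - 1)), lies above it
    by [powR_le_bernoulli], and its linear part averages to zero. *)
Lemma sum_powR_le (m : nat) (g : R) (w s : 'I_m -> R) : 0 <= g <= 1 ->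
  (forall i, 0 <= w i) -> \sum_i w i = 1 -> (forall i, 0 < s i) ->
  \sum_i w i * s i `^ g <= (\sum_i w i * s i) `^ g.
Proof.
move=> g01 w0 w1 s0; set S := \sum_i w i * s i.
have S0 : 0 < S by exact: weighted_sum_gt0.
apply: (@le_trans _ _ (\sum_i w i * (S `^ g * (1 + g * (s i / S - 1))))).
  apply: ler_sum => i _; apply: ler_wpM2l => //.
  have {1}-> : s i = S * (s i / S) by rewrite mulrCA divff ?mulr1 // gt_eqF.
  rewrite powRM ?(ltW S0) ?(ltW (divr_gt0 (s0 i) S0)) // ler_wpM2l ?powR_ge0 //.
  by apply: powR_le_bernoulli => //; rewrite divr_gt0.
have -> : \sum_i w i * (S `^ g * (1 + g * (s i / S - 1))) =
  \sum_i (w i * (S `^ g * (1 - g)) + w i * s i * (S `^ g * g / S)).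
  by apply: eq_bigr => i _; ring.
rewrite big_split /= -!mulr_suml w1 -/S mul1r.
have -> : S * (S `^ g * g / S) = S `^ g * g.
  by rewrite mulrC divfK // gt_eqF.
by rewrite -mulrDr subrK mulr1.
Qed.

(* Expand [(U i s i^(-g/2) - P S^(-g) s i^(g/2))^2 >= 0], where [P] and [S] are
   the averages of U and s. *)
Lemma sum_sqr_powRN_ge (m : nat) (g : R) (w s U : 'I_m -> R) : 0 <= g <= 1 ->
  (forall i, 0 <= w i) -> \sum_i w i = 1 -> (forall i, 0 < s i) ->
  (\sum_i w i * U i) ^+ 2 * (\sum_i w i * s i) `^ (- g) <=
    \sum_i w i * (U i ^+ 2 * s i `^ (- g)).
Proof.
move=> g01 w0 w1 s0; have := sum_powR_le g01 w0 w1 s0.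
set S := \sum_i w i * s i; set P := \sum_i w i * U i => Hg.
have S0 : 0 < S by exact: weighted_sum_gt0.
rewrite powRN; set B := S `^ g in Hg *.
have B0 : 0 < B by rewrite powR_gt0.
(* Averaged, this is 2 P^2 / B minus P^2 / B^2 times the average of s^g, and [Hg] bounds that
   average by [B]. *)
apply: (@le_trans _ _ (\sum_i w i * (2 * U i * P * B^-1 - P ^+ 2 * B ^-2 * s i `^ g))).
  have -> : \sum_i w i * (2 * U i * P * B^-1 - P ^+ 2 * B ^-2 * s i `^ g) =
      \sum_i (w i * U i * (2 * P / B) - w i * s i `^ g * (P ^+ 2 * B ^-2)).
    by apply: eq_bigr => i _; ring.
  rewrite sumrB -!mulr_suml -/P.
  have -> : P * (2 * P / B) = P ^+ 2 / B + P ^+ 2 * B ^-2 * B.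
    by field; rewrite gt_eqF.
  rewrite -addrA lerDl subr_ge0 mulrC ler_wpM2l // mulr_ge0 ?sqr_ge0 //.
  by rewrite invr_ge0 sqr_ge0.
apply: ler_sum => i _; apply: ler_wpM2l => //.
rewrite powRN; set b := s i `^ g; have b0 : 0 < b by rewrite powR_gt0.
rewrite -subr_ge0.
have -> : U i ^+ 2 / b - (2 * U i * P / B - P ^+ 2 * B ^-2 * b) = (U i - P / B * b) ^+ 2 / b.
  by field; rewrite !gt_eqF.
by rewrite divr_ge0 ?sqr_ge0 // ltW.
Qed.

End Powers.

(** * Local Lipschitz bounds from partial derivatives *)

Section Lipschitz.
Context {R : realType}.

Lemma segment_lipschitz (V : normedModType R) (f : V -> R) (z v : V) (h M : R) :
  (forall t, 0 <= t <= 1 ->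
    derivable f (z + (h * t) *: v) v /\ `|'D_v f (z + (h * t) *: v)| <= M) ->
  `|f (z + h *: v) - f z| <= M * `|h|.
Proof.
move=> H.
have d t : 0 <= t <= 1 ->
    is_derive (t : R) 1 (fun k => f (z + (h * k) *: v)) (h * 'D_v f (z + (h * t) *: v)).
  by move=> t01; apply: is_derive_lineZ; exact: (H _ t01).1.
have [||c] := @MVT R (fun k => f (z + (h * k) *: v))
    (fun t => h * 'D_v f (z + (h * t) *: v)) 0 1 ltr01.
- by move=> t; rewrite in_itv /= => /andP[t0 t1]; apply: d; rewrite !ltW.
- apply: derivable_within_continuous => t; rewrite in_itv /= => t01.
  exact: (@ex_derive _ _ _ _ _ _ _ (d t t01)).
rewrite in_itv /= => /andP[c0 c1].
rewrite mulr0 scale0r addr0 mulr1 subr0 mulr1 => ->.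
by rewrite normrM mulrC ler_wpM2r // (H c _).2 // !ltW.
Qed.

(** Only derivatives along the axes are controlled, so z is joined to y by a path parallel to the
    axes. The balls are those of a sup norm, so the whole path stays in the ball around z; each of
    its n + 1 legs costs at most M |y - z|. *)
Lemma C1_locally_lipschitz (n : nat) (u : 'rV[R]_n * R -> R) (z : 'rV[R]_n * R) (M : R) :
  (\forall y \near z, [/\ forall i, derivable u y (space_dir i) /\ `|dx i u y| <= M,
     derivable u y time_dir & `|dt u y| <= M]) ->
  exists2 C, 0 <= C & \forall y \near z, `|u y - u z| <= C * `|y - z|.
Proof.
move=> /nbhs_ballP[e /= e0 He].
have M0 : 0 <= M.
  have [_ _] := He z (ballxx z e0); exact: le_trans.
exists (M *+ n + M); first by rewrite addr_ge0 // mulrn_wge0.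
apply/nbhs_ballP; exists e => //= y yz.
(* [y1 k] has the first k space coordinates of y and the others of z. *)
pose y1 k := (\row_i (if (i < k)%N then y.1 0 i else z.1 0 i), z.2) : 'rV[R]_n * R.
have coord i : `|y.1 0 i - z.1 0 i| <= `|y - z|.
  have -> : y.1 0 i - z.1 0 i = (y - z).1 0 i by rewrite /= !mxE.
  apply: le_trans (_ : `|(y - z).1| <= _); last by rewrite prod_normE le_max lexx.
  rewrite [X in _ <= X]/Num.norm /= mx_normrE.
  exact: (le_bigmax _ (fun ij => `|(y - z).1 ij.1 ij.2|) (0, i)).
have coord2 : `|y.2 - z.2| <= `|y - z| by rewrite prod_normE le_max lexx orbT.
have yze : `|y - z| < e by rewrite distrC; move: yz; rewrite -ball_normE.
have inball (a : 'rV[R]_n * R) : (forall i, `|a.1 0 i - z.1 0 i| <= `|y - z|) ->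
    `|a.2 - z.2| <= `|y - z| -> ball z e a.
  move=> a1 a2; split; last by rewrite /ball /= distrC (le_lt_trans a2).
  by split=> // i j; rewrite ord1 /ball /= distrC (le_lt_trans (a1 j)).
have tle (t c N : R) : 0 <= t <= 1 -> `|c| <= N -> `|c * t| <= N.
  move=> /andP[t0 t1] cN; apply: le_trans cN.
  by rewrite normrM (ger0_norm t0) ler_piMr.
have step k : (k <= n)%N -> `|u (y1 k) - u z| <= M *+ k * `|y - z|.
  elim: k => [_|k IH kn].
    have -> : y1 0%N = z by rewrite [RHS]surjective_pairing; congr pair; apply/rowP => i; rewrite mxE.
    by rewrite subrr normr0 mulr0n mul0r.
  pose o : 'I_n := Ordinal kn.
  have -> : y1 k.+1 = y1 k + (y.1 0 o - z.1 0 o) *: space_dir o.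
    rewrite /y1 /space_dir; congr pair; last by rewrite /= scaler0 addr0.
    apply/rowP => i; rewrite !mxE eqxx /= ltnS leq_eqVlt.
    have -> : (i == o) = (i == k :> nat) by [].
    case: eqP => [ik|ik] /=; last by rewrite mulr0 addr0.
    rewrite ik ltnn mulr1.
    have -> : i = o by apply: val_inj.
    by rewrite addrC subrK.
  rewrite mulrSr mulrDl -(subrK (u (y1 k)) (u _)) -addrA addrC.
  apply: le_trans (ler_normD _ _) _; apply: lerD; first exact: IH (ltnW kn).
  apply: le_trans (_ : M * `|y.1 0 o - z.1 0 o| <= _); last exact: ler_wpM2l.
  apply: segment_lipschitz => t t01.
  have [|H _ _] := He (y1 k + ((y.1 0 o - z.1 0 o) * t) *: space_dir o); last exact: H.
  apply: inball => [i|]; last by rewrite /= scaler0 addr0 subrr normr0.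
  rewrite /= !mxE eqxx /=.
  have -> : (i == o) = (i == k :> nat) by [].
  case: eqP => [ik|ik]; last by rewrite mulr0 addr0; case: ifP; rewrite ?subrr ?normr0.
  rewrite ik ltnn mulr1 addrAC subrr add0r.
  exact: tle.
have yE : y1 n + (y.2 - z.2) *: time_dir = y.
  rewrite [RHS]surjective_pairing /y1 /time_dir; congr pair.
    by apply/rowP => i; rewrite !mxE ltn_ord mulr0 addr0.
  by rewrite /= [_ *: _]mulr1 addrC subrK.
rewrite mulrDl -(subrK (u (y1 n)) (u _)) -addrA addrC.
apply: le_trans (ler_normD _ _) _; apply: lerD; first exact: step.
apply: le_trans (_ : M * `|y.2 - z.2| <= _); last exact: ler_wpM2l.
rewrite -{1}yE; apply: segment_lipschitz => t t01.
have [|_ H1 H2] := He (y1 n + ((y.2 - z.2) * t) *: time_dir); last by [].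
apply: inball => [i|]; first by rewrite /= !mxE ltn_ord mulr0 addr0.
by rewrite /= [_ *: _]mulr1 addrAC subrr add0r; exact: tle.
Qed.

End Lipschitz.

(** * Supremal convolution *)

Section SupConvolution.
Context {R : realType} {E : normedModType R} {m : nat}.
Variables (w : 'I_m -> R) (V : E -> R) (K : set E).
Hypothesis V_continuous : {within K, continuous V}.

(** Tuples become row vectors whenever a topology on them is needed: products of compact sets are
    then compact by [rV_compact]. *)
Lemma row_entry_continuous (j : 'I_m) : continuous (fun Y : 'rV[E]_m => Y 0 j).
Proof.
move=> Y A /= /(nbhs_ballP (Y 0 j)) [e e0 eA].
by apply/nbhs_ballP; exists e => //= Z [_ YZ]; exact/eA/YZ.
Qed.

Lemma comb_continuous : continuous (fun Y : 'rV[E]_m => \sum_i w i *: Y 0 i).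
Proof.
apply: (continuous_big add_continuous) => i _ Y.
exact: (continuous_comp (@row_entry_continuous i Y) (@scaler_continuous _ _ (w i) _)).
Qed.

Lemma weighted_values_continuous :
  {within [set Y : 'rV[E]_m | forall i, K (Y 0 i)],
    continuous (fun Y : 'rV[E]_m => \sum_i w i * V (Y 0 i))}.
Proof.
apply/subspace_continuousP => Y KY.
apply: (cvg_big add_continuous) => i _; apply: cvgMl_tmp.
have /subspace_continuousP VK := V_continuous.
apply: (@cvg_comp _ _ _ (fun Y' : 'rV[E]_m => Y' 0 i) V _ (within K (nbhs (Y 0 i)))); last exact: VK.
move=> A; rewrite /within /= => YA.
have := @row_entry_continuous i Y _ YA.
exact: (@filterS _ (nbhs Y) _ _ _ (fun Z H KZ => H (KZ i))).
Qed.

(** Averaging is a proper map on tuples from [K]: all tuples whose average is close to z stay in one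
    compact set. At z itself this gives a maximizer; uniformity near z gives semicontinuity. *)
Hypothesis w_proper : forall z : E, exists C : set E, [/\ compact C, C `<=` K &
  \forall z' \near z, forall Y : 'I_m -> E, (forall i, K (Y i)) ->
    \sum_i w i *: Y i = z' -> forall i, C (Y i)].

Let values_within C : C `<=` K ->
  {within [set Y : 'rV[E]_m | forall i, C (Y 0 i)],
    continuous (fun Y : 'rV[E]_m => \sum_i w i * V (Y 0 i))}.
Proof.
by move=> CK; apply: continuous_subspaceW weighted_values_continuous => Y CY i; exact: CK.
Qed.

Lemma sup_convolution_attained (Y0 : 'I_m -> E) : (forall i, K (Y0 i)) ->
  exists Y : 'I_m -> E, [/\ forall i, K (Y i),
    \sum_i w i *: Y i = \sum_i w i *: Y0 i &
    forall Y', (forall i, K (Y' i)) -> \sum_i w i *: Y' i = \sum_i w i *: Y0 i ->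
      \sum_i w i * V (Y' i) <= \sum_i w i * V (Y i)].
Proof.
move=> KY0; set z := \sum_i w i *: Y0 i.
have [C [cC CK /nbhs_singleton Cz]] := w_proper z.
pose A := [set Y : 'rV[E]_m | forall i, C (Y 0 i)] `&`
  (fun Y : 'rV[E]_m => \sum_i w i *: Y 0 i) @^-1` [set z].
have rowE (Y : 'I_m -> E) (F : 'I_m -> E -> E) :
    \sum_i F i ((\row_i Y i) 0 i) = \sum_i F i (Y i).
  by apply: eq_bigr => i _; rewrite mxE.
have AY Y : (forall i, K (Y i)) -> \sum_i w i *: Y i = z -> A (\row_i Y i).
  move=> KY Yz; split => [i|]; first by rewrite mxE; exact: Cz.
  by rewrite /= (rowE Y (fun i y => w i *: y)).
have cA : compact A.
  apply: compact_closedI; first exact: (@rV_compact E m (fun=> C)).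
  apply: preimage_closed => [Y _|]; first exact: comb_continuous.
  by apply: compact_closed; [exact: norm_hausdorff|exact: compact_set1].
have [||Y] := @compact_EVT_max _ R (fun Y : 'rV[E]_m => \sum_i w i * V (Y 0 i)) A _ cA.
- by exists (\row_i Y0 i); exact: AY.
- by apply: continuous_subspaceW (values_within CK) => Y [].
rewrite inE => -[CY Yz] maxY; exists (fun i => Y 0 i); split=> // [i|Y' KY' Y'z].
  exact/CK/CY.
have := maxY (\row_i Y' i) (mem_set (AY _ KY' Y'z)).
by under eq_bigr do rewrite mxE.
Qed.

(** The pairs (average, value) over tuples from the compact set [C] form a compact set. The averages
    reached with value at least a are therefore a closed set [B], which misses z, hence also a
    neighbourhood of z. *)
Lemma sup_convolution_usc (z : E) (a : R) :
  (forall Y : 'I_m -> E, (forall i, K (Y i)) -> \sum_i w i *: Y i = z ->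
    \sum_i w i * V (Y i) < a) ->
  \forall z' \near z, forall Y : 'I_m -> E, (forall i, K (Y i)) ->
    \sum_i w i *: Y i = z' -> \sum_i w i * V (Y i) < a.
Proof.
move=> za; have [C [cC CK Cz]] := w_proper z.
pose A := [set Y : 'rV[E]_m | forall i, C (Y 0 i)].
have cA : compact A by exact: (@rV_compact E m (fun=> C)).
pose g (Y : 'rV[E]_m) : E * R := (\sum_i w i *: Y 0 i, \sum_i w i * V (Y 0 i)).
have cgA : compact (g @` A).
  apply: continuous_compact => //; apply/subspace_continuousP => Y AY.
  have /subspace_continuousP /(_ Y AY) h2 := values_within CK.
  have h1 : \sum_i w i *: Y' 0 i @[Y' --> within A (nbhs Y)] --> \sum_i w i *: Y 0 i.
    move=> B /(@comb_continuous Y); exact: (@filterS _ (nbhs Y) _ _ _ (fun Z H _ => H)).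
  have FF : Filter (within A (nbhs Y)) by apply: within_filter; exact: nbhs_filter.
  exact: (@cvg_pair 'rV[E]_m E R (within A (nbhs Y)) _ _ FF _ _
    (fun Y => \sum_i w i *: Y 0 i) (fun Y => \sum_i w i * V (Y 0 i)) h1 h2).
pose B := fst @` ((g @` A) `&` (snd @^-1` [set r | a <= r])).
have cB : closed B.
  apply: compact_closed; first exact: norm_hausdorff.
  apply: continuous_compact; last first.
    apply: compact_closedI => //; apply: preimage_closed; last exact: closed_ge.
    by move=> x _; exact: cvg_snd.
  by apply: continuous_subspaceT => x; exact: cvg_fst.
have /open_nbhs_nbhs : open_nbhs z (~` B).
  split; first exact: closed_openC.
  case=> -[_ r] [[[Y AY] [<- <-]] /= ar] Yz.
  by move: ar; rewrite leNgt za // => i; exact/CK/AY.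
apply: filterS2 Cz => z' /= Cz' Bz' Y KY Yz'.
rewrite ltNge; apply/negP => aY; apply: Bz'; exists (g (\row_i Y i)).
  split; last by rewrite /g /=; under eq_bigr do rewrite mxE.
  by exists (\row_i Y i) => // i; rewrite mxE; exact: Cz'.
by rewrite /g /=; under eq_bigr do rewrite mxE.
Qed.

End SupConvolution.

Lemma within_continuous_comp (T U W : topologicalType) (A : set T) (B : set U)
    (g : T -> U) (f : U -> W) :
  {within A, continuous g} -> (forall x, A x -> B (g x)) ->
  {within B, continuous f} -> {within A, continuous (f \o g)}.
Proof.
move=> /subspace_continuousP cg AB /subspace_continuousP cf.
apply/subspace_continuousP => x Ax.
apply: (@cvg_comp _ _ _ g f _ (within B (nbhs (g x)))); last exact/cf/AB.
move=> C /(cg x Ax); rewrite /within /= => H.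
exact: (@filterS2 _ (nbhs x) _ _ _ _ (fun y h1 _ Ay => h1 Ay (AB y Ay)) H H).
Qed.

Section Combinations.
Context {R : realType} {n m : nat}.
Implicit Types (w : 'I_m -> R) (Y : 'I_m -> 'rV[R]_n * R).

Lemma comb_fst w Y : (\sum_i w i *: Y i).1 = \sum_i w i *: (Y i).1.
Proof. by rewrite (raddf_sum (@fst 'rV[R]_n R)). Qed.

Lemma comb_snd w Y : (\sum_i w i *: Y i).2 = \sum_i w i * (Y i).2.
Proof. by rewrite (raddf_sum (@snd 'rV[R]_n R)). Qed.

End Combinations.

(** * The power change of the time variable *)

Section Warp.
Context {R : realType} {n : nat}.
Implicit Types (Omega : set 'rV[R]_n) (z : 'rV[R]_n * R) (a : R).

Definition warp a z : 'rV[R]_n * R := (z.1, z.2 `^ a).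

(* In the variables [(x, s) = (x, t ^ alpha)] and [v = u ^ p], the envelope is
   an ordinary supremal convolution. *)
Definition warped (u : 'rV[R]_n * R -> R) (alpha p : R) z : R :=
  u (warp alpha^-1 z) `^ p.

Lemma warpVK a z : a != 0 -> 0 <= z.2 -> warp a (warp a^-1 z) = z.
Proof.
case: z => x t /= a0 t0; congr pair.
by rewrite /= -powRrM mulVf // powRr1.
Qed.

Lemma warpKV a z : a != 0 -> 0 <= z.2 -> warp a^-1 (warp a z) = z.
Proof. by move=> a0; rewrite -{2}[a]invrK; apply: warpVK; rewrite invr_eq0. Qed.

Lemma closed_cylinder_warp Omega a z :
  closed_cylinder Omega z -> closed_cylinder Omega (warp a z).
Proof. by case=> z1 z2; split=> //=; exact: powR_ge0. Qed.

Lemma cylinder_warp Omega a z : cylinder Omega z -> cylinder Omega (warp a z).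
Proof. by case=> z1 z2; split=> //=; exact: powR_gt0. Qed.

Lemma warp_continuous Omega a : 0 < a ->
  {within closed_cylinder Omega, continuous (warp a)}.
Proof.
move=> a0; pose g z : 'rV[R]_n * R := (z.1, `|z.2| `^ a).
apply: (@subspace_eq_continuous _ _ _ g).
  by move=> z; rewrite inE => -[_ z0]; rewrite /g ger0_norm.
apply: continuous_subspaceT => z.
have h1 : fst y @[y --> z] --> z.1 by exact: cvg_fst.
have h2 : snd y @[y --> z] --> z.2 by exact: cvg_snd.
have h3 : `|y.2| `^ a @[y --> z] --> `|z.2| `^ a.
  exact: (continuous_comp h2 (@continuous_norm_powR R a a0 z.2)).
exact: (cvg_pair h1 h3).
Qed.

Lemma cylinderW Omega z : cylinder Omega z -> closed_cylinder Omega z.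
Proof. by move=> [z1 z2]; split; [exact: subset_closure|exact: ltW]. Qed.

Lemma open_cylinder Omega : open Omega -> open (cylinder Omega).
Proof.
move=> oO; rewrite openE => -[x t] [/= Ox t0].
exists (Omega, [set t : R | 0 < t]); last by move=> -[].
by split; apply: open_nbhs_nbhs; split => //; exact: open_gt.
Qed.

Lemma closed_cylinder_dichotomy Omega z : open Omega ->
  closed_cylinder Omega z -> cylinder_boundary Omega z \/ cylinder Omega z.
Proof.
move=> oO [z1 z2]; have [Oz|Oz] := pselect (Omega z.1); last first.
  by left; left; split=> //; split=> //; move/interior_subset.
move: z2; rewrite /= le_eqVlt => /predU1P[z20|z2]; last by right.
by left; right; split => //=.
Qed.

End Warp.

(** * The envelope as a supremal convolution *)

Section Envelope.
Context {R : realType} {n : nat}.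
Variables (Omega : set 'rV[R]_n) (alpha p : R) (u : 'rV[R]_n * R -> R).
Hypotheses (oO : open Omega) (bO : bounded_set Omega) (cO : convex_set Omega).
Hypotheses (alpha_gt0 : 0 < alpha) (p_gt0 : 0 < p).
Hypothesis u_continuous : {within closed_cylinder Omega, continuous u}.
Hypothesis u_ge0 : forall z, closed_cylinder Omega z -> 0 <= u z.
Hypothesis u_boundary : forall z, cylinder_boundary Omega z -> u z = 0.
Variable w : 'I_n.+1 -> R.
Hypothesis w_simplex : open_simplex n.+1 w.

Let w_gt0 i : 0 < w i. Proof. by have /andP[] := w_simplex.1 i. Qed.
Let w_sum : \sum_i w i = 1 := w_simplex.2.
Let a_neq0 : alpha != 0. Proof. by rewrite gt_eqF. Qed.
Let p_neq0 : p != 0. Proof. by rewrite gt_eqF. Qed.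

Local Notation K := (closed_cylinder Omega).
Local Notation V := (warped u alpha p).
Local Notation env z := (fine (lambda_envelope Omega alpha p u w z)).

Lemma warped_ge0 z : 0 <= V z.
Proof. exact: powR_ge0. Qed.

Lemma warped_continuous : {within K, continuous V}.
Proof.
pose g z := `|u (warp alpha^-1 z)| `^ p.
apply: (@subspace_eq_continuous _ _ _ g).
  move=> z; rewrite inE => Kz; rewrite /g ger0_norm // u_ge0 //.
  exact: closed_cylinder_warp.
have uw : {within K, continuous (u \o warp alpha^-1)}.
  apply: within_continuous_comp u_continuous; last exact: closed_cylinder_warp.
  by apply: warp_continuous; rewrite invr_gt0.
move=> z; exact: (continuous_comp (uw z) (@continuous_norm_powR R p p_gt0 _)).
Qed.

(** The space components stay in the closure of a bounded set. The time components are nonnegative,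
    so nothing cancels: each w_i s_i is at most the average time, itself at most |z.2| + 1 for
    averages within distance 1 of z. Summing over i in [T] gives one bound for all components. *)
Lemma comb_proper (z : 'rV[R]_n * R) : exists C : set ('rV[R]_n * R), [/\ compact C, C `<=` K &
  \forall z' \near z, forall Y : 'I_n.+1 -> 'rV[R]_n * R, (forall i, K (Y i)) ->
    \sum_i w i *: Y i = z' -> forall i, C (Y i)].
Proof.
pose T := \sum_i (`|z.2| + 1) / w i.
exists (closure Omega `*` `[0, T]); split.
- apply: compact_setX; last exact: segment_compact.
  apply: bounded_closed_compact; last exact: closed_closure.
  have [M [Mr HM]] := bO; exists M; split=> // b Mb x.
  have cb : closed [set y : 'rV[R]_n | `|y| <= b].
    apply: (@preimage_closed _ _ (fun y : 'rV[R]_n => `|y|) [set r | r <= b]).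
      by move=> y _; exact: norm_continuous.
    exact: closed_le.
  move=> Ox; have : closure [set y : 'rV[R]_n | `|y| <= b] x.
    by apply: closureS Ox => y /(HM _ Mb).
  by rewrite -(closure_id _).1.
- move=> y [y1 /=]; rewrite in_itv /= => /andP[y2 _]; by split.
apply/nbhs_ballP; exists 1 => //= z' [_ zz'] Y KY Yz' i; split; first exact: (KY i).1.
rewrite /= in_itv /= (KY i).2 /=.
apply: (@le_trans _ _ ((`|z.2| + 1) / w i)); last first.
  rewrite /T (bigD1 i) //= lerDl sumr_ge0 // => j _.
  by rewrite divr_ge0 ?addr_ge0 // ltW.
rewrite ler_pdivlMr // mulrC.
apply: (@le_trans _ _ z'.2).
  rewrite -Yz' comb_snd (bigD1 i) //= lerDl sumr_ge0 // => j _.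
  by rewrite mulr_ge0 ?(ltW (w_gt0 _)) // (KY j).2.
have := ler_norm (z'.2 - z.2); have := ler_norm z.2.
by move: zz'; rewrite /ball /= distrC; lra.
Qed.

Lemma envelope_pointsP z Y : K z -> envelope_points Omega alpha w z Y ->
  (forall i, K (warp alpha (Y i))) /\ \sum_i w i *: warp alpha (Y i) = warp alpha z.
Proof.
move=> Kz [KY z1 z2]; split=> [i|]; first exact: closed_cylinder_warp.
rewrite [LHS]surjective_pairing comb_fst comb_snd /warp /= z1 z2; congr pair.
rewrite /power_mean -powRrM mulVf // powRr1 // sumr_ge0 // => i _.
by rewrite mulr_ge0 ?powR_ge0 // ltW.
Qed.

Lemma envelope_pointsP_inv z Y : K z -> (forall i, K (Y i)) ->
  \sum_i w i *: Y i = warp alpha z ->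
  envelope_points Omega alpha w z (fun i => warp alpha^-1 (Y i)).
Proof.
move=> Kz KY Yz; split=> [i||]; first exact: closed_cylinder_warp.
  by have := congr1 fst Yz; rewrite comb_fst /= => <-.
have := congr1 snd Yz; rewrite comb_snd /power_mean /= => Yz2.
have -> : \sum_i w i * ((Y i).2 `^ alpha^-1) `^ alpha = \sum_i w i * (Y i).2.
  by apply: eq_bigr => i _; rewrite -powRrM mulVf // powRr1 // (KY i).2.
by rewrite Yz2 -powRrM mulfV // powRr1 //; exact: Kz.2.
Qed.

(** The interface between the extended-real supremum and the supremal convolution: finiteness and
    all bounds on the envelope are obtained from such a maximizer. The constant tuple is the
    competitor that shows the fibre to be nonempty. *)
Lemma envelope_spec z : K z -> exists Y : 'I_n.+1 -> 'rV[R]_n * R,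
  [/\ forall i, K (Y i), \sum_i w i *: Y i = warp alpha z,
   forall Y', (forall i, K (Y' i)) -> \sum_i w i *: Y' i = warp alpha z ->
     \sum_i w i * V (Y' i) <= \sum_i w i * V (Y i) &
   lambda_envelope Omega alpha p u w z = ((\sum_i w i * V (Y i)) `^ p^-1)%:E].
Proof.
move=> Kz.
have sw : \sum_i w i *: warp alpha z = warp alpha z by rewrite -scaler_suml w_sum scale1r.
have [Y [KY Yz maxY]] := sup_convolution_attained warped_continuous comb_proper
  (Y0 := fun=> warp alpha z) (fun=> closed_cylinder_warp alpha Kz).
rewrite sw in Yz maxY; exists Y; split=> //.
have sum0 Y' : 0 <= \sum_i w i * V (Y' i).
  by rewrite sumr_ge0 // => i _; rewrite mulr_ge0 ?warped_ge0 // ltW.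
apply/eqP; rewrite eq_le; apply/andP; split.
  apply: ge_ereal_sup => _ [Y' Y'z <-]; rewrite lee_fin /power_mean.
  have [KY' Y'zE] := envelope_pointsP Kz Y'z.
  have sumE : \sum_i w i * u (Y' i) `^ p = \sum_i w i * V (warp alpha (Y' i)).
    have [KY0 _ _] := Y'z.
    by apply: eq_bigr => i _; rewrite /warped warpKV //; exact: (KY0 i).2.
  have le : \sum_i w i * u (Y' i) `^ p <= \sum_i w i * V (Y i).
    by apply: le_trans (maxY _ KY' Y'zE); rewrite le_eqVlt sumE eqxx.
  apply: ge0_ler_powR le; rewrite ?invr_ge0 ?nnegrE ?(ltW p_gt0) //.
  by rewrite sumr_ge0 // => i _; rewrite mulr_ge0 ?powR_ge0 // ltW.
apply: ereal_sup_ubound; exists (fun i => warp alpha^-1 (Y i)) => //.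
exact: envelope_pointsP_inv.
Qed.

Lemma envelope_usc (z : 'rV[R]_n * R) (a : R) : K z -> env z < a ->
  \forall y \near within K (nbhs z), env y < a.
Proof.
move=> Kz za; have [Y [KY Yz maxY envz]] := envelope_spec Kz.
rewrite envz /= in za.
have a0 : 0 < a by apply: le_lt_trans za; exact: powR_ge0.
have sum0 Y' : 0 <= \sum_i w i * V (Y' i).
  by rewrite sumr_ge0 // => i _; rewrite mulr_ge0 ?warped_ge0 // ltW.
have powE (b : R) : 0 <= b -> (b `^ p^-1 < a) = (b < a `^ p).
  move=> b0; have powK (c q : R) : q != 0 -> 0 <= c -> (c `^ q) `^ q^-1 = c.
    by move=> q0 c0; rewrite -powRrM mulfV // powRr1.
  apply/idP/idP => [|] H.
    rewrite -[b](powK b p^-1) ?invr_eq0 // invrK.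
    by rewrite gt0_ltr_powR // nnegrE ?powR_ge0 // ltW.
  rewrite -[a](powK a p) ?(ltW a0) //.
  by rewrite gt0_ltr_powR ?invr_gt0 // nnegrE ?powR_ge0.
have za' Y' : (forall i, K (Y' i)) -> \sum_i w i *: Y' i = warp alpha z ->
    \sum_i w i * V (Y' i) < a `^ p.
  by move=> KY' Y'z; apply: le_lt_trans (maxY _ KY' Y'z) _; rewrite -powE.
have H := sup_convolution_usc warped_continuous comb_proper za'.
have /subspace_continuousP /(_ z Kz) wc := @warp_continuous _ _ Omega alpha alpha_gt0.
apply: (@filterS _ (nbhs z) _ _ _ _ (wc _ H)) => y Hy Ky; have {}Hy := Hy Ky.
have [Y' [KY' Y'y _ ->]] := envelope_spec Ky.
by rewrite /= powE // Hy.
Qed.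

(** Over a boundary point the maximizer consists of boundary points, where u vanishes. At the
    lateral boundary, a single component over [Omega] would pull the average into [Omega]; at the
    bottom, nonnegative times with zero average are all zero. *)
Lemma envelope_boundary z : cylinder_boundary Omega z ->
  lambda_envelope Omega alpha p u w z = 0%E.
Proof.
move=> bz; have Kz : K z.
  by case: bz => -[]; [move=> []|]; split=> //; [exact: subset_closure|rewrite /= ]; rewrite (_ : z.2 = 0).
have [Y [KY Yz _ ->]] := envelope_spec Kz.
rewrite big1 ?powR0 ?invr_eq0 // => i _.
suff bY : cylinder_boundary Omega (warp alpha^-1 (Y i)).
  by rewrite /warped u_boundary // powR0 // mulr0.
case: bz => [[[_ Oz] _]|[_ z20]].
  left; split=> /=; last exact: powR_ge0; split; first exact: (KY i).1.
  move=> OY; apply: Oz; rewrite (interior_id _).1 //.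
  have -> : z.1 = \sum_i w i *: (Y i).1 by rewrite -comb_fst Yz.
  apply: (convex_closure_open_sum cO (j := i)) => //; last exact: interior_subset.
    by move=> j; exact: ltW.
  by move=> j; exact: (KY j).1.
have Yi0 : (Y i).2 = 0.
  have : \sum_i w i * (Y i).2 = 0 by rewrite -comb_snd Yz /= z20 powR0.
  move/(psumr_eq0P (fun j _ => mulr_ge0 (ltW (w_gt0 j)) (KY j).2))/(_ i isT)/eqP.
  by rewrite mulf_eq0 gt_eqF //= => /eqP.
have Yi : (warp alpha^-1 (Y i)).2 = 0 by rewrite /= Yi0 powR0 // invr_eq0.
have := closed_cylinder_warp alpha^-1 (KY i).
by move=> /(closed_cylinder_dichotomy oO)[//|[_]]; rewrite /= -/(warp _ _) Yi0 powR0 ?invr_eq0 // ltxx.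
Qed.

End Envelope.

(** * Maximizers are interior *)

Lemma linear_bound_cvg {R : realType} {W : normedModType R} (g : R -> W) (l : W) (C : R) :
  0 <= C -> (\forall r \near (0 : R), `|g r - l| <= C * `|r|) ->
  g r @[r --> (0 : R)] --> l.
Proof.
move=> C0 gC; apply/cvgrPdist_lt => e e0.
have : \forall r \near (0 : R), `|r| < e / (C + 1).
  apply/nbhs_ballP; exists (e / (C + 1)); first by rewrite /= divr_gt0 // ltr_wpDl.
  by move=> r; rewrite /ball /= sub0r normrN.
apply: filterS2 gC => r gr re; rewrite distrC; apply: (le_lt_trans gr).
move: re; rewrite ltr_pdivlMr ?ltr_wpDl //; apply: le_lt_trans.
by rewrite mulrC ler_wpM2l // lerDl.
Qed.

(** Here [g] will be u along a curve oblique in space and time, for which a Lipschitz bound at 0 is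
    at hand rather than a derivative. *)
Lemma derivable_comp_lipschitz {R : realType} (f g : R -> R) (C : R) :
  0 <= C -> derivable f (g 0) 1 ->
  (\forall r \near (0 : R), `|g r - g 0| <= C * `|r|) ->
  exists2 C', 0 <= C' & \forall r \near (0 : R), `|f (g r) - f (g 0)| <= C' * `|r|.
Proof.
move=> C0 /derivable_locally_lipschitz[B B0 HB] gC.
exists (B * C); first exact: mulr_ge0.
have gto : g r - g 0 @[r --> (0 : R)] --> (0 : R).
  by apply: (linear_bound_cvg C0); apply: filterS gC => r; rewrite subr0.
have H := gto _ HB; rewrite /= in H.
apply: filterS2 gC H => r gr /= Hr.
move: Hr; rewrite [g 0 + _]addrC subrK => /le_trans; apply.
by rewrite -mulrA ler_wpM2l.
Qed.

Lemma C21_locally_lipschitz {R : realType} {n : nat} (D : set ('rV[R]_n * R))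
    (u : 'rV[R]_n * R -> R) z : open D -> C21 D u -> D z ->
  exists2 C, 0 <= C & \forall y \near z, `|u y - u z| <= C * `|y - z|.
Proof.
move=> oD [_ [dt1 dt2] dx1 _] Dz.
have bnd (g : 'rV[R]_n * R -> R) : {within D, continuous g} ->
    \forall y \near z, `|g y| <= `|g z| + 1.
  rewrite continuous_open_subspace // => /(_ z (mem_set Dz)) /cvgrPdist_lt /(_ 1 ltr01).
  apply: filterS => y gy; rewrite -[g y](subKr (g z)).
  by rewrite (le_trans (ler_normB _ _)) // lerD2l ltW.
pose M := `|dt u z| + 1 + \sum_i (`|dx i u z| + 1).
apply: (@C1_locally_lipschitz _ _ _ _ M).
have Mt : `|dt u z| + 1 <= M.
  by rewrite lerDl sumr_ge0 // => i _; rewrite addr_ge0.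
have Mx i : `|dx i u z| + 1 <= M.
  by rewrite /M (bigD1 i) //= addrCA lerDl !(addr_ge0, sumr_ge0).
have nD : \forall y \near z, D y by exact: open_nbhs_nbhs.
have nx : \forall y \near z, forall i, `|dx i u y| <= M.
  apply: (@filter_forall _ _ (fun i y => `|dx i u y| <= M) (nbhs z)) => i; have := bnd _ (dx1 i).2.
  by apply: filterS => y yz; exact: le_trans yz (Mx i).
apply: filterS3 nD nx (bnd _ dt2) => y Dy dxy dty; split.
- by move=> i; split; [exact: (dx1 i).1|exact: dxy].
- exact: dt1.
- exact: le_trans Mt.
Qed.

Section Lines.
Context {R : realType} {n : nat}.
Implicit Types (u : 'rV[R]_n * R -> R).

Lemma time_line (x : 'rV[R]_n) (t : R) : (x, t) = (x, 0) + t *: time_dir.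
Proof. by congr pair; rewrite /= ?scaler0 ?addr0 // add0r [RHS]mulr1. Qed.

Lemma is_derive_time u (x : 'rV[R]_n) (t : R) : derivable u (x, t) time_dir ->
  is_derive t 1 (fun s => u (x, s)) (dt u (x, t)).
Proof.
move=> du; have -> : (fun s => u (x, s)) = (fun s => u ((x, 0) + s *: time_dir)).
  by apply/funext => s; rewrite -time_line.
by rewrite /dt time_line; apply: is_derive_line; rewrite -time_line.
Qed.

End Lines.

(** * Monotonicity and positivity of the solution *)

Section Solution.
Context {R : realType} {n : nat}.
Variables (Omega : set 'rV[R]_n) (alpha p : R) (u : 'rV[R]_n * R -> R).
Hypotheses (oO : open Omega).
Hypotheses (alpha_gt0 : 0 < alpha) (p_gt0 : 0 < p).
Hypothesis u_continuous : {within closed_cylinder Omega, continuous u}.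
Hypothesis u_C21 : C21 (cylinder Omega) u.
Hypothesis u_boundary : forall z, cylinder_boundary Omega z -> u z = 0.
Hypothesis u_monotone : forall z, cylinder Omega z -> 0 <= dt u z.

Local Notation K := (closed_cylinder Omega).
Local Notation D := (cylinder Omega).
Local Notation V := (warped u alpha p).

(** Over the boundary of [Omega] both values are 0. Inside, the sign of [dt u] is used on the open
    time interval only, and continuity on the closed cylinder admits s = 0. *)
Lemma solution_time_monotone (x : 'rV[R]_n) (s t : R) :
  closure Omega x -> 0 <= s -> s <= t -> u (x, s) <= u (x, t).
Proof.
move=> Ox s0 st; have [Oix|Oix] := pselect (Omega x); last first.
  by rewrite !u_boundary //; left; split => //=; rewrite ?(le_trans s0) //;
    split=> // /interior_subset.
have d r : r \in `]s, t[ -> is_derive r 1 (fun s => u (x, s)) (dt u (x, r)).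
  rewrite in_itv /= => /andP[sr _]; apply: is_derive_time.
  by case: u_C21 => _ [dtu _] _ _; apply: dtu; split => //=; exact: le_lt_trans sr.
apply: (@ger0_derive1_le_cc R (fun s => u (x, s)) s t); rewrite ?in_itv /= ?lexx ?st //.
- by move=> r /d[].
- move=> r rst; rewrite derive1E (@derive_val _ _ _ _ _ _ _ (d r rst)) u_monotone //.
  by split => //=; move: rst; rewrite in_itv /= => /andP[sr _]; exact: le_lt_trans sr.
apply: (@within_continuous_comp _ _ _ _ K (fun r => (x, r)) u) => //.
  apply: continuous_subspaceT => r.
  have h1 : x @[_ --> r] --> x by exact: cvg_cst.
  have h2 : y @[y --> r] --> r by exact: cvg_id.
  exact: (cvg_pair h1 h2).
by move=> r; rewrite /= in_itv /= => /andP[sr _]; split => //=; exact: le_trans sr.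
Qed.

Lemma solution_ge0 z : K z -> 0 <= u z.
Proof.
case: z => x t [/= Ox t0].
apply: le_trans (solution_time_monotone Ox (lexx 0) t0).
rewrite u_boundary //.
have [Oix|Oix] := pselect (Omega x); first by right.
by left; split => //=; split=> // /interior_subset.
Qed.

Hypothesis u_growth : forall x y : 'rV[R]_n, closure Omega x -> Omega y ->
      (u (x + rho *: unit_direction x y, rho `^ alpha^-1)) `^ p / rho
        @[rho --> 0^'+] --> +oo.

(** Condition (ii) with y = x, hence direction 0, makes u(x, .) positive at arbitrarily small times;
    monotonicity in time carries this up to t. *)
Lemma solution_gt0 z : D z -> 0 < u z.
Proof.
case: z => x t [/= Ox t0].
have /cvgryPgt /(_ 0) := u_growth (subset_closure Ox) Ox.
rewrite /unit_direction eqxx => H.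
have : \forall r \near 0^'+, 0 < r < t `^ alpha.
  near=> r; apply/andP; split; near: r; first exact: nbhs_right_gt.
  by apply: nbhs_right_lt; rewrite powR_gt0.
move=> /(filterI H) /filter_ex[r [+ /andP[r0 rt]]].
rewrite scaler0 addr0 pmulr_lgt0 ?invr_gt0 // => ur.
have rt' : r `^ alpha^-1 <= t.
  have -> : t = (t `^ alpha) `^ alpha^-1.
    by rewrite -powRrM mulfV ?gt_eqF // powRr1 // ltW.
  by apply: ge0_ler_powR; rewrite ?nnegrE ?invr_ge0 ?powR_ge0 ?ltW.
have Ox' := subset_closure Ox.
have Kr : K (x, r `^ alpha^-1) by split => //=; exact: powR_ge0.
apply: lt_le_trans (gt0_powR p_gt0 (solution_ge0 Kr) ur) _.
by apply: solution_time_monotone => //; exact: powR_ge0.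
Unshelve. all: by end_near. Qed.

(** Bounds the loss when an interior component is moved. At an interior point the time and the value
    of u are positive, so both powers in V are differentiated at positive arguments. *)
Lemma warped_lipschitz_ray z d : D z ->
  exists2 C, 0 <= C & \forall r \near (0 : R), `|V (z + r *: d) - V z| <= C * `|r|.
Proof.
move=> Dz; have Dwz := cylinder_warp alpha^-1 Dz.
pose q r := (z.2 + r * d.2) `^ alpha^-1.
have q0 : q 0 = z.2 `^ alpha^-1 by rewrite /q mul0r addr0.
have dq : derivable q 0 1.
  have d1 : is_derive (0 : R) 1 (fun r => z.2 + r * d.2) d.2.
    have := @is_derive_line R R id z.2 d.2 0.
    move=> /(_ (@derivable_id _ _ _ _)).
    by rewrite derive_id.
  have [|//] := is_derive_powR_comp alpha^-1 (g := fun r => z.2 + r * d.2) _ d1.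
  by rewrite mul0r addr0; exact: Dz.2.
have [B B0 HB] := derivable_locally_lipschitz dq.
have [C C0 HC] := C21_locally_lipschitz (open_cylinder oO) u_C21 Dwz.
pose g r := u (z.1 + r *: d.1, q r).
have gE r : g r = u (warp alpha^-1 (z + r *: d)) by [].
have g0 : g 0 = u (warp alpha^-1 z) by rewrite gE scale0r addr0.
have Vg r : V (z + r *: d) = g r `^ p by [].
have [|||E E0 HE] := @derivable_comp_lipschitz R (fun y => y `^ p) g (C * (`|d.1| + B)).
- by rewrite mulr_ge0 // addr_ge0.
- by apply: derivable_powR; rewrite in_itv /= andbT g0 solution_gt0.
- have dist : \forall r \near (0 : R),
      `|warp alpha^-1 (z + r *: d) - warp alpha^-1 z| <= (`|d.1| + B) * `|r|.
    apply: filterS HB => r; rewrite add0r q0 => Hr.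
    rewrite prod_normE ge_max; apply/andP; split.
      by rewrite /= addrAC subrr add0r normrZ mulrC ler_wpM2r // lerDl.
    by apply: le_trans Hr _; rewrite ler_wpM2r // lerDr.
  have h1 : z.1 + r *: d.1 @[r --> (0 : R)] --> z.1.
    rewrite -[X in _ --> X]addr0 -(scale0r d.1).
    by apply: cvgD; [exact: cvg_cst|exact: cvgZr_tmp].
  have h2 : q r @[r --> (0 : R)] --> q 0.
    by apply: differentiable_continuous; apply/derivable1_diffP.
  have cv : warp alpha^-1 (z + r *: d) @[r --> (0 : R)] --> (z.1, q 0).
    exact: cvg_pair h1 h2.
  rewrite q0 in cv.
  have H := cv _ HC; rewrite /= in H.
  apply: filterS2 dist H => r Hd Hr; rewrite g0 gE.
  by apply: le_trans Hr _; rewrite -mulrA ler_wpM2l.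
exists E; first exact: E0.
have Vz : V z = g 0 `^ p by rewrite g0.
by rewrite Vz; exact: HE.
Qed.

End Solution.

Section EuclideanNorm.
Context {R : realType} {n : nat}.

Lemma euclidean_norm_gt0 (x : 'rV[R]_n) : x != 0 -> 0 < euclidean_norm x.
Proof.
move=> x0; rewrite sqrtr_gt0 lt_neqAle sumr_ge0 ?andbT => [|i _]; last exact: sqr_ge0.
rewrite eq_sym; apply: contraNneq x0 => s0; apply/eqP/rowP => i.
have /eqP := psumr_eq0P (fun i _ => sqr_ge0 (x 0 i)) s0 (i := i) isT.
by rewrite sqrf_eq0 mxE => /eqP.
Qed.

End EuclideanNorm.

Section WarpedSolution.
Context {R : realType} {n : nat}.
Variables (Omega : set 'rV[R]_n) (alpha p : R) (u : 'rV[R]_n * R -> R).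
Hypotheses (oO : open Omega) (cO : convex_set Omega).
Hypotheses (alpha_gt0 : 0 < alpha) (p_gt0 : 0 < p).
Hypothesis u_continuous : {within closed_cylinder Omega, continuous u}.
Hypothesis u_C21 : C21 (cylinder Omega) u.
Hypothesis u_boundary : forall z, cylinder_boundary Omega z -> u z = 0.
Hypothesis u_monotone : forall z, cylinder Omega z -> 0 <= dt u z.
Hypothesis u_growth : forall x y : 'rV[R]_n, closure Omega x -> Omega y ->
      (u (x + rho *: unit_direction x y, rho `^ alpha^-1)) `^ p / rho
        @[rho --> 0^'+] --> +oo.
Local Notation K := (closed_cylinder Omega).
Local Notation D := (cylinder Omega).
Local Notation V := (warped u alpha p).

Lemma warped_boundary z : K z -> ~ D z -> V z = 0.
Proof.
move=> Kz Dz; rewrite /warped u_boundary ?powR0 ?gt_eqF //.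
have [//|[Oz z2]] := closed_cylinder_dichotomy oO (closed_cylinder_warp alpha^-1 Kz).
case: Dz; split=> //=; apply: gt0_powR z2; rewrite ?invr_gt0 //.
exact: Kz.2.
Qed.

Lemma warped_gt0 z : D z -> 0 < V z.
Proof.
move=> Dz; rewrite powR_gt0 // (solution_gt0 alpha_gt0 p_gt0 u_continuous u_C21 u_boundary u_monotone u_growth) //.
exact: cylinder_warp.
Qed.

Lemma closure_ray (x y : 'rV[R]_n) : closure Omega x -> Omega y ->
  \forall r \near 0^'+, closure Omega (x + r *: unit_direction x y).
Proof.
move=> Ox Oy; have [xy|xy] := eqVneq x y.
  by near=> r; rewrite /unit_direction xy eqxx scaler0 addr0 -xy.
set N := euclidean_norm (y - x).
have N0 : 0 < N by rewrite euclidean_norm_gt0 // subr_eq0 eq_sym.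
near=> r.
have rN : r <= N by near: r; exact: nbhs_right_le.
have r0 : 0 < r by near: r; exact: nbhs_right_gt.
rewrite /unit_direction (negbTE xy) -/N scalerA.
have -> : x + (r / N) *: (y - x) = (1 - r / N) *: x + (r / N) *: y.
  by rewrite scalerBr scalerBl scale1r [RHS]addrAC -addrA.
apply: (convex_setP (convex_closure cO)) => //.
- exact: subset_closure.
- by rewrite subr_ge0 ler_pdivrMr // mul1r.
- by rewrite divr_ge0 // ltW.
- by rewrite subrK.
Unshelve. all: by end_near. Qed.

(** Condition (ii) starts at time 0, while z may lie at a later time. After the displacement the
    warped time z.2 + r is still at least r, so monotonicity transfers the bound. The arbitrary
    slope [A] expresses superlinear growth. *)
Lemma warped_growth (z : 'rV[R]_n * R) (y : 'rV[R]_n) (A : R) : K z -> Omega y ->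
  \forall r \near 0^'+, K (z + r *: (unit_direction z.1 y, 1)) /\
    A * r <= V (z + r *: (unit_direction z.1 y, 1)).
Proof.
move=> Kz Oy; have /cvgryPge /(_ A) H := u_growth Kz.1 Oy.
have HK := closure_ray Kz.1 Oy; near=> r.
have r0 : 0 < r by near: r; exact: nbhs_right_gt.
have Kr : closure Omega (z.1 + r *: unit_direction z.1 y) by near: r.
have z2 : 0 <= z.2 := Kz.2.
have zr : r <= z.2 + r *: 1 by rewrite [r *: 1]mulr1 lerDr.
split; first by split=> //=; exact: le_trans (ltW r0) zr.
have : A <= u (z.1 + r *: unit_direction z.1 y, r `^ alpha^-1) `^ p / r by near: r.
rewrite (ler_pdivlMr _ _ r0) => Hr.
apply: (@le_trans _ _ (u (z.1 + r *: unit_direction z.1 y, r `^ alpha^-1) `^ p)).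
  exact: Hr.
have K1 : K (z.1 + r *: unit_direction z.1 y, r `^ alpha^-1).
  by split=> //=; exact: powR_ge0.
have le1 : r `^ alpha^-1 <= (z.2 + r *: 1) `^ alpha^-1.
  by apply: ler_powRl (ltW r0) zr; rewrite invr_ge0 ltW.
have le2 := solution_time_monotone u_continuous u_C21 u_boundary u_monotone
  Kr (powR_ge0 _ _) le1.
have u0 := solution_ge0 u_continuous u_C21 u_boundary u_monotone K1.
exact: (ler_powRl (ltW p_gt0) u0 le2).
Unshelve. all: by end_near. Qed.

End WarpedSolution.

Section InteriorMaximizer.
Context {R : realType} {n m : nat}.
Variables (Omega : set 'rV[R]_n) (V : 'rV[R]_n * R -> R) (w : 'I_m -> R).
Hypotheses (oO : open Omega) (w_gt0 : forall i, 0 < w i) (w_sum : \sum_i w i = 1).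

Local Notation K := (closed_cylinder Omega).
Local Notation D := (cylinder Omega).

Hypothesis V_boundary : forall z, K z -> ~ D z -> V z = 0.
Hypothesis V_gt0 : forall z, D z -> 0 < V z.
Hypothesis V_lipschitz : forall z d, D z ->
  exists2 C, 0 <= C & \forall r \near (0 : R), `|V (z + r *: d) - V z| <= C * `|r|.
Hypothesis V_growth : forall z y A, K z -> Omega y ->
  \forall r \near 0^'+, K (z + r *: (unit_direction z.1 y, 1)) /\
    A * r <= V (z + r *: (unit_direction z.1 y, 1)).

(* If Y i were on the boundary and Y j inside, moving Y i by r towards Y j (in
   space and time) and Y j back accordingly would gain superlinearly in r at
   Y i, and lose at most linearly at Y j. *)
Lemma maximizer_interior z (Y : 'I_m -> 'rV[R]_n * R) : D z ->
  (forall i, K (Y i)) -> \sum_i w i *: Y i = z ->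
  (forall Y', (forall i, K (Y' i)) -> \sum_i w i *: Y' i = z ->
    \sum_i w i * V (Y' i) <= \sum_i w i * V (Y i)) ->
  forall i, D (Y i).
Proof.
move=> Dz KY Yz maxY i; apply: contrapT => nDi.
(* Otherwise the maximal value would be 0, less than the value V(z) of the constant tuple. *)
have [j Dj] : exists j, D (Y j).
  apply: contrapT => nD.
  have wz : \sum_i w i *: z = z by rewrite -scaler_suml w_sum scale1r.
  have wc (v : R) : \sum_i w i * v = v by rewrite -mulr_suml w_sum mul1r.
  have := maxY (fun=> z) (fun=> cylinderW Dz) wz; rewrite (wc (V z)).
  rewrite big1 => [|k _].
    by apply/negP; rewrite -ltNge; exact: V_gt0.
  by rewrite V_boundary ?mulr0 // => Dk; apply: nD; exists k.
have ij : j != i by apply/eqP => ji; apply: nDi; rewrite -ji.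
pose d : 'rV[R]_n * R := (unit_direction (Y i).1 (Y j).1, 1).
(* With this ratio, moving Y_i by r d and Y_j by -c r d leaves the weighted average fixed. *)
pose c := w i / w j.
have c0 : 0 < c by rewrite divr_gt0.
have [C C0 HC] := V_lipschitz (- c *: d) Dj.
(* The slope makes the weighted gain at Y_i at least w_j C r + w_i r: the first term pays for the
   loss at Y_j, the second is a strict surplus. *)
have HG := V_growth (C / c + 1) (KY i) Dj.1.
have HD : \forall r \near (0 : R), D (Y j + r *: (- c *: d)).
  have cv : Y j + r *: (- c *: d) @[r --> (0 : R)] --> Y j.
    rewrite -[X in _ --> X]addr0 -(scale0r (- c *: d)).
    by apply: cvgD; [exact: cvg_cst|exact: cvgZr_tmp].
  by apply: cv; apply: open_nbhs_nbhs; split; [exact: open_cylinder|].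
have HH : \forall r \near 0^'+, [/\ 0 < r, K (Y i + r *: d),
    (C / c + 1) * r <= V (Y i + r *: d), D (Y j + r *: (- c *: d)) &
    `|V (Y j + r *: (- c *: d)) - V (Y j)| <= C * `|r|].
  near=> r; have [H1 H2] : K (Y i + r *: d) /\ (C / c + 1) * r <= V (Y i + r *: d) by near: r.
  split; [|exact: H1|exact: H2| |]; near: r; first exact: nbhs_right_gt.
    exact: cvg_within HD.
  exact: cvg_within HC.
have /filter_ex[r [r0 K1 V1 D1 V2]] := HH.
pose Y' k := if k == i then Y i + r *: d else if k == j then Y j + r *: (- c *: d) else Y k.
have Y'i : Y' i = Y i + r *: d by rewrite /Y' eqxx.
have Y'j : Y' j = Y j + r *: (- c *: d) by rewrite /Y' (negbTE ij) eqxx.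
have sumE (W : zmodType) (F : ('rV[R]_n * R) -> 'I_m -> W) :
    \sum_k F (Y' k) k = \sum_k F (Y k) k + (F (Y' i) i - F (Y i) i) + (F (Y' j) j - F (Y j) j).
  rewrite (bigD1 i) //= (bigD1 j) //= [in RHS](bigD1 i) //= [in RHS](bigD1 j) //=.
  rewrite (eq_bigr (fun k => F (Y k) k)) => [|k /andP[/negbTE ki /negbTE kj]]; last first.
    by rewrite /Y' ki kj.
  set S := \sum_(k < _ | _) _; set a := F (Y' i) i; set b := F (Y i) i.
  set a' := F (Y' j) j; set b' := F (Y j) j.
  have h (x y T : W) : y + T + (x - y) = x + T by rewrite addrC addrA subrK.
  by rewrite h -addrA h.
have : \sum_k w k * V (Y' k) <= \sum_k w k * V (Y k).
  apply: maxY => [k|].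
    rewrite /Y'; case: ifP => // _; case: ifP => // _; exact: cylinderW.
  rewrite (sumE _ (fun y k => w k *: y)) Yz Y'i Y'j !scalerDr.
  rewrite [w i *: Y i + _]addrC [w j *: Y j + _]addrC !addrK !scalerA -addrA -scalerDl.
  have -> : w i * r + w j * r * - c = 0 by rewrite /c; field; rewrite gt_eqF.
  by rewrite scale0r addr0.
rewrite (sumE _ (fun y k => w k * V y)) Y'i Y'j (V_boundary (KY i)) // mulr0 subr0.
rewrite -addrA gerDl leNgt => /negP; apply.
rewrite -mulrBr.
have wE : w i * ((C / c + 1) * r) = w j * (C * r) + w i * r.
  by rewrite /c; field; rewrite !gt_eqF.
have Vi := ler_wpM2l (ltW (w_gt0 i)) V1; rewrite wE in Vi.
rewrite (gtr0_norm r0) ler_norml in V2; case/andP: V2 => V2 _.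
have Vj := ler_wpM2l (ltW (w_gt0 j)) V2; rewrite mulrN in Vj.
have wr : 0 < w i * r by rewrite mulr_gt0.
by rewrite (lt_le_trans wr) // -lerBlDr; apply: le_trans Vi; rewrite addrC lerD2r lerNl.
Unshelve. all: by end_near. Qed.

End InteriorMaximizer.

(** * The differential inequality at a touching point *)

Section Algebra.
Context {R : realType} {n m : nat}.

(* Here [a = v ^ (p - 1)], so that [U = v ^ p].  Displacing the i-th point by
   [U i / P] times the displacement of the average makes the gradient terms of
   both sides equal. *)
Lemma viscosity_algebra (w v a U s tau F : 'I_m -> R) (d dd : 'I_m -> 'I_n -> R)
    (v0 a0 P T F0 g : R) (d0 dd0 : 'I_n -> R) (p : R) :
  (0 < m)%N -> (forall i, 0 < w i) -> \sum_i w i = 1 ->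
  0 <= g <= 1 -> (forall i, 0 < s i) ->
  (forall i, 0 < v i) -> (forall i, 0 < a i) -> 0 < v0 -> 0 < a0 ->
  (forall i, U i = v i * a i) -> P = v0 * a0 -> \sum_i w i * U i = P ->
  (forall i k, a0 * d0 k = a i * d i k) ->
  (forall i, a0 * T * (\sum_i w i * s i) `^ g = a i * tau i * s i `^ g) ->
  (forall k, \sum_i w i * (a i * ((U i / P) ^+ 2 * dd i k) +
      (p - 1) * (a i / v i) * (U i / P * d i k) ^+ 2) <=
    a0 * dd0 k + (p - 1) * (a0 / v0) * d0 k ^+ 2) ->
  (forall i, tau i = \sum_k dd i k + F i) -> (forall i, 0 <= tau i) ->
  \sum_i w i * (U i ^+ 2 * a i * F i) <= P ^+ 2 * a0 * F0 ->
  T <= \sum_k dd0 k + F0.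
Proof.
move=> m0 w0 w1 g01 s0 v_gt0 a_gt0 v0_gt0 a0_gt0 UE PE sumU H1 H2 H3 H4 tau0 H5.
have P0 : 0 < P by rewrite PE mulr_gt0.
pose c i := U i / P.
have sumc : \sum_i w i * c i = 1.
  by under eq_bigr do rewrite mulrA; rewrite -mulr_suml sumU divff // gt_eqF.
(* By [H1] the i-th gradient term is w_i U_i times a constant independent of i. As the w_i U_i sum
   to P, the total is the gradient term on the right, and both are dropped. *)
have K k : \sum_i w i * (a i * (c i ^+ 2 * dd i k)) <= a0 * dd0 k.
  have := H3 k; rewrite (eq_bigr (fun i => w i * (a i * (c i ^+ 2 * dd i k)) +
      w i * U i * ((p - 1) * (a0 * d0 k) ^+ 2 / P ^+ 2))) => [|i _]; last first.
    rewrite mulrDr; congr (_ + _).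
    rewrite (H1 i k) UE /c; field.
    by rewrite !gt_eqF.
  rewrite big_split /= -mulr_suml sumU.
  have -> : P * ((p - 1) * (a0 * d0 k) ^+ 2 / P ^+ 2) = (p - 1) * (a0 / v0) * d0 k ^+ 2.
    by rewrite PE; field; rewrite !gt_eqF.
  by rewrite lerD2r.
have {}K : \sum_i w i * c i ^+ 2 * (a i * tau i) - \sum_i w i * c i ^+ 2 * (a i * F i)
    <= a0 * \sum_k dd0 k.
  have : \sum_k \sum_i w i * (a i * (c i ^+ 2 * dd i k)) <= \sum_k a0 * dd0 k.
    by apply: ler_sum => k _; exact: K.
  rewrite -mulr_sumr exchange_big /=; congr (_ <= _).
  rewrite -sumrB; apply: eq_bigr => i _.
  rewrite -!mulr_sumr H4; ring.
set S := \sum_i w i * s i in H2.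
have S0 : 0 < S by apply: weighted_sum_gt0 => // i; exact: ltW.
(* By [H2] this is the value of a_i tau_i s_i^g for every i. Its sign, read at any one index, allows
   multiplying the convexity inequality for c_i^2 s_i^(-g) by it; the c_i average to 1. *)
pose kap := a0 * T * S `^ g.
have kap0 : 0 <= kap.
  by rewrite /kap (H2 (Ordinal m0)) !mulr_ge0 ?powR_ge0 // ltW.
have L1 : a0 * T <= \sum_i w i * c i ^+ 2 * (a i * tau i).
  have -> : \sum_i w i * c i ^+ 2 * (a i * tau i) =
      kap * \sum_i w i * (c i ^+ 2 * s i `^ (- g)).
    rewrite mulr_sumr; apply: eq_bigr => i _.
    rewrite /kap (H2 i) powRN; field.
    by rewrite gt_eqF // powR_gt0.
  have := @sum_sqr_powRN_ge R m g w s c g01 (fun i => ltW (w0 i)) w1 s0.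
  rewrite sumc expr1n mul1r -/S => /(ler_wpM2l kap0); apply: le_trans.
  by rewrite /kap powRN mulfK // gt_eqF // powR_gt0.
have L2 : \sum_i w i * c i ^+ 2 * (a i * F i) <= a0 * F0.
  have -> : \sum_i w i * c i ^+ 2 * (a i * F i) =
      (\sum_i w i * (U i ^+ 2 * a i * F i)) / P ^+ 2.
    by rewrite mulr_suml; apply: eq_bigr => i _; rewrite /c; field; rewrite gt_eqF.
  rewrite ler_pdivrMr ?exprn_gt0 //.
  by have -> : a0 * F0 * P ^+ 2 = P ^+ 2 * a0 * F0 by ring.
by rewrite -(ler_pM2l a0_gt0) mulrDr; lra.
Qed.

End Algebra.

(** * Derivative tests for a function touching an average from above *)

Section Gap.
Context {R : realType} {m : nat}.
Implicit Types (w : 'I_m -> R).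

Lemma is_derive_gap w (f0 : R -> R) (f : 'I_m -> R -> R) (d0 h : R) (d : 'I_m -> R) :
  is_derive h 1 f0 d0 -> (forall i, is_derive h 1 (f i) (d i)) ->
  is_derive h 1 (fun k => f0 k - \sum_i w i * f i k) (d0 - \sum_i w i * d i).
Proof.
move=> D0 D; have D1 i : is_derive h 1 (w i \*: f i) (w i * d i) := is_deriveZ (w i) (D i).
have := is_deriveB D0 (is_derive_sum D1).
suff -> : f0 - \sum_i (w i \*: f i) = (fun k => f0 k - \sum_i w i * f i k) by [].
by apply/funext => k; rewrite /= fctE fct_sumE.
Qed.

Lemma gap_first_test w (f0 d0 : R -> R) (f d : 'I_m -> R -> R) :
  (\forall h \near (0 : R), is_derive (h : R) 1 f0 (d0 h)) ->
  (forall i, \forall h \near (0 : R), is_derive (h : R) 1 (f i) (d i h)) ->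
  \sum_i w i * f i 0 = f0 0 ->
  (\forall h \near (0 : R), \sum_i w i * f i h <= f0 h) ->
  \sum_i w i * d i 0 = d0 0.
Proof.
move=> D0 D E0 E.
have DD := @filter_forall _ _ (fun i (h : R) => is_derive (h : R) 1 (f i) (d i h)) (nbhs (0 : R)) (nbhs_filter (0 : R)) D.
have H := @first_derivative_test R (fun h => f0 h - \sum_i w i * f i h)
  (fun h => d0 h - \sum_i w i * d i h).
apply/eqP; rewrite eq_sym -subr_eq0; apply/eqP; apply: H.
  exact: (@filterS2 _ (nbhs (0 : R)) (nbhs_filter (0 : R)) _ _ _ (fun h h0 hi => is_derive_gap w h0 hi) D0 DD).
by apply: filterS E => h /=; rewrite E0 subrr subr_ge0.
Qed.

Lemma gap_second_test w (f0 d0 : R -> R) (f d : 'I_m -> R -> R) (e0 : R) (e : 'I_m -> R) :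
  (\forall h \near (0 : R), is_derive (h : R) 1 f0 (d0 h)) ->
  (forall i, \forall h \near (0 : R), is_derive (h : R) 1 (f i) (d i h)) ->
  is_derive (0 : R) 1 d0 e0 -> (forall i, is_derive (0 : R) 1 (d i) (e i)) ->
  \sum_i w i * f i 0 = f0 0 ->
  (\forall h \near (0 : R), \sum_i w i * f i h <= f0 h) ->
  \sum_i w i * e i <= e0.
Proof.
move=> D0 D De0 De E0 E.
have DD := @filter_forall _ _ (fun i (h : R) => is_derive (h : R) 1 (f i) (d i h)) (nbhs (0 : R)) (nbhs_filter (0 : R)) D.
have D1 : \forall h \near (0 : R), is_derive (h : R) (1 : R) (fun h : R => f0 h - \sum_i w i * f i h)
    (d0 h - \sum_i w i * d i h).
  exact: (@filterS2 _ (nbhs (0 : R)) (nbhs_filter (0 : R)) _ _ _ (fun h h0 hi => is_derive_gap w h0 hi) D0 DD).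
have [|_] := second_derivative_test D1 (is_derive_gap w De0 De).
  by apply: filterS E => h /=; rewrite E0 subrr subr_ge0.
by rewrite subr_ge0.
Qed.

End Gap.

(** * Derivatives of a warped function along coordinate lines *)

Section WarpedLines.
Context {R : realType} {n : nat}.
Variables (Omega : set 'rV[R]_n) (alpha p : R) (u : 'rV[R]_n * R -> R).
Hypotheses (oO : open Omega) (u_C21 : C21 (cylinder Omega) u).
Local Notation D := (cylinder Omega).
Variable z : 'rV[R]_n * R.
Hypothesis Dz : D z.
Let y := warp alpha^-1 z.
Hypothesis u_pos : \forall y' \near y, 0 < u y'.

Lemma warp_space_dir (b r : R) k : warp b (z + r *: space_dir k) = warp b z + r *: space_dir k.
Proof. by rewrite /warp; congr pair; rewrite /= scaler0 !addr0. Qed.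

Lemma line_cvg (a v : 'rV[R]_n * R) (c : R) : a + (c * h) *: v @[h --> (0 : R)] --> a.
Proof.
rewrite -[X in _ --> X]addr0 -(scale0r v).
apply: cvgD; first exact: cvg_cst.
apply: cvgZr_tmp; rewrite -[X in _ --> X](mulr0 c).
exact: (@mulrl_continuous R c 0).
Qed.

Let near_line (c : R) (v : 'rV[R]_n * R) : \forall h \near (0 : R),
  D (y + (c * h) *: v) /\ 0 < u (y + (c * h) *: v).
Proof.
have Dy : D y by exact: cylinder_warp.
have nD : \forall y' \near y, D y'.
  exact: (open_nbhs_nbhs (conj (open_cylinder oO) Dy)).
exact: (line_cvg v c (filterI nD u_pos)).
Qed.

Lemma warped_space_derive (c : R) k : \forall h \near (0 : R),
  is_derive (h : R) 1 (fun h => warped u alpha p (z + (c * h) *: space_dir k))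
    (p * u (y + (c * h) *: space_dir k) `^ (p - 1) * (c * dx k u (y + (c * h) *: space_dir k))).
Proof.
have -> : (fun h => warped u alpha p (z + (c * h) *: space_dir k)) =
    (fun h => u (y + (c * h) *: space_dir k) `^ p).
  by apply/funext => h; rewrite /warped warp_space_dir.
apply: filterS (near_line c (space_dir k)) => h [Dh uh].
apply: is_derive_powR_comp => //; apply: is_derive_lineZ.
by case: u_C21 => _ _ dxu _; exact: (dxu k).1.
Qed.

Lemma warped_space_derive2 (c : R) k :
  is_derive (0 : R) 1 (fun h => p * u (y + (c * h) *: space_dir k) `^ (p - 1) *
      (c * dx k u (y + (c * h) *: space_dir k)))
    (p * (u y `^ (p - 1) * (c ^+ 2 * dx k (dx k u) y) +
      (p - 1) * u y `^ (p - 1 - 1) * (c * dx k u y) ^+ 2)).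
Proof.
have y0 : y + (c * 0) *: space_dir k = y by rewrite mulr0 scale0r addr0.
have Dy : D y by exact: cylinder_warp.
have [_ _ dxu dxxu] := u_C21.
pose g h := u (y + (c * h) *: space_dir k).
pose dg h := c * dx k u (y + (c * h) *: space_dir k).
have g0 : g 0 = u y by rewrite /g y0.
have dg0 : dg 0 = c * dx k u y by rewrite /dg y0.
have d1 : is_derive (0 : R) 1 g (dg 0).
  by apply: is_derive_lineZ; rewrite y0; exact: (dxu k).1.
have d2 : is_derive (0 : R) 1 dg (c ^+ 2 * dx k (dx k u) y).
  have := @is_derive_lineZ _ _ (dx k u) y (space_dir k) c 0.
  rewrite y0 => /(_ ((dxxu k k).1 _ Dy)) d3.
  have := is_deriveZ c d3; rewrite expr2 -mulrA; exact.
have gpos : 0 < g 0 by rewrite g0; exact: nbhs_singleton u_pos.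
have := is_derive_powR_comp2 p gpos d1 d2.
by rewrite g0 dg0.
Qed.

(** The change of time variable contributes the power of exponent 1/alpha - 1; this exponent is the
    [g] of [viscosity_algebra]. *)
Lemma warped_time_derive (c : R) : 0 < alpha -> \forall h \near (0 : R),
  is_derive (h : R) 1 (fun h => warped u alpha p (z + (c * h) *: time_dir))
    (p * u (warp alpha^-1 (z + (c * h) *: time_dir)) `^ (p - 1) *
      (dt u (warp alpha^-1 (z + (c * h) *: time_dir)) *
        (alpha^-1 * (z.2 + c * h) `^ (alpha^-1 - 1) * c))).
Proof.
move=> a0.
have lineE h : z + (c * h) *: time_dir = (z.1, z.2 + c * h).
  by rewrite /time_dir [LHS]surjective_pairing /= scaler0 addr0 [_ *: 1]mulr1.
have nD : \forall h \near (0 : R), D (z + (c * h) *: time_dir).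
  exact: (line_cvg time_dir c (open_nbhs_nbhs (conj (open_cylinder oO) Dz))).
have nu : \forall h \near (0 : R), 0 < u (warp alpha^-1 (z + (c * h) *: time_dir)).
  have /subspace_continuousP /(_ z (cylinderW Dz)) wc :
    {within closed_cylinder Omega, continuous (warp alpha^-1)}.
    by apply: warp_continuous; rewrite invr_gt0.
  have := line_cvg time_dir c (wc _ u_pos).
  by apply: filterS2 nD => h Dh H; exact: (H (cylinderW Dh)).
apply: filterS2 nD nu => h Dh uh.
rewrite lineE in Dh uh *.
have -> : (fun h => warped u alpha p (z + (c * h) *: time_dir)) =
    (fun h => u (z.1, (z.2 + c * h) `^ alpha^-1) `^ p).
  by apply/funext => r; rewrite lineE.
have d1 : is_derive h 1 (fun r => z.2 + c * r) c.
  have := @is_derive_lineZ _ R id z.2 1 c h (@derivable_id _ _ _ _).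
  rewrite derive_id mulr1.
  by have -> // : (fun k => id (z.2 + (c * k) *: 1)) = (fun r => z.2 + c * r); apply/funext => r; rewrite /= [_ *: 1]mulr1.
have d2 := is_derive_powR_comp alpha^-1 (g := fun r => z.2 + c * r) Dh.2 d1.
have du : derivable u (z.1, (z.2 + c * h) `^ alpha^-1) time_dir.
  by case: u_C21 => _ [dtu _] _ _; apply: dtu; exact: (cylinder_warp alpha^-1 Dh).
have d3 := @is_derive1_comp R (fun s => u (z.1, s)) (fun r => (z.2 + c * r) `^ alpha^-1) h _ _ (is_derive_time du) d2.
exact: (is_derive_powR_comp p (g := fun r => u (z.1, (z.2 + c * r) `^ alpha^-1)) uh d3).
Qed.

End WarpedLines.

Lemma sum_indicator {R : realType} {m : nat} (w F : 'I_m -> R) (i : 'I_m) :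
  \sum_j w j * (F j * (j == i)%:R) = w i * F i.
Proof.
rewrite (bigD1 i) //= eqxx mulr1 big1 ?addr0 // => j /negbTE ->.
by rewrite !mulr0.
Qed.

(** Substituting v^p turns the exponent 3 - 1/p into 3p - 1, the exponent of U^2 a with U = v^p and
    a = v^(p-1): exactly the weight that the source carries in [viscosity_algebra]. The last
    argument becomes theta / a. *)
Lemma transformed_sourceE {R : realType} {n : nat}
    (f : ('rV[R]_n * R) * R * 'rV[R]_n -> R) (alpha p v : R) (theta : 'rV[R]_n)
    (z : 'rV[R]_n * R) : 0 < v -> 0 < p ->
  transformed_source f alpha p theta (z, v `^ p) =
  (v `^ p) ^+ 2 * v `^ (p - 1) *
    f (warp alpha^-1 z, v, (v `^ (p - 1))^-1 *: theta).
Proof.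
move=> v0 p0; case: z => x t; rewrite /transformed_source /warp /=.
have pV : p * p^-1 = 1 by rewrite mulfV // gt_eqF.
rewrite -!powRrM pV powRr1 ?ltW // ![p * (_ - _)]mulrBr pV mulr1 -powRN opprB; congr (_ * _).
have vn0 : v != 0 by rewrite gt_eqF.
have pn0 : p != 0 by rewrite gt_eqF.
rewrite -powR_mulrn ?powR_ge0 // -powRrM -powRD ?vn0 ?implybT //.
congr (_ `^ _); ring.
Qed.

(** * Contact at interior maximizers *)

Section ViscosityCore.
Context {R : realType} {n m : nat}.
Variables (Omega : set 'rV[R]_n) (f : ('rV[R]_n * R) * R * 'rV[R]_n -> R).
Variables (alpha p : R) (u phi : 'rV[R]_n * R -> R).
Hypotheses (oO : open Omega) (cO : convex_set Omega).
Hypotheses (alpha_bounds : 1 / 2 <= alpha <= 1) (p_gt0 : 0 < p).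
Hypothesis u_C21 : C21 (cylinder Omega) u.
Hypothesis phi_C21 : C21 (cylinder Omega) phi.
Hypothesis u_gt0 : forall z, cylinder Omega z -> 0 < u z.
Hypothesis u_eq : forall z, cylinder Omega z -> dt u z = rhs f u z.
Hypothesis u_monotone : forall z, cylinder Omega z -> 0 <= dt u z.
Hypothesis f_concave : forall theta : 'rV[R]_n,
  concave_on (cylinder Omega `*` [set v : R | 0 < v]) (transformed_source f alpha p theta).
Variables (w : 'I_m -> R) (Y : 'I_m -> 'rV[R]_n * R) (z : 'rV[R]_n * R).
Hypotheses (w_gt0 : forall i, 0 < w i) (w_sum : \sum_i w i = 1) (m_gt0 : (0 < m)%N).

Local Notation D := (cylinder Omega).
Local Notation V := (warped u alpha p).
Local Notation P := (warped phi alpha p).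

Hypotheses (Dz : D z) (DY : forall i, D (Y i)) (Yz : \sum_i w i *: Y i = z).
Hypothesis phi_pos : \forall y \near warp alpha^-1 z, 0 < phi y.
Hypothesis touch_eq : \sum_i w i * V (Y i) = P z.
(** The coefficients are left free because two choices are made: an indicator for the first
    derivatives, and V(Y_i) / P(z) for the second ones. The average moves at speed equal to the
    weighted sum of the [c i]. *)
Hypothesis touch_le : forall (c : 'I_m -> R) (d : 'rV[R]_n * R),
  \forall h \near (0 : R), \sum_i w i * V (Y i + (c i * h) *: d) <=
    P (z + ((\sum_i w i * c i) * h) *: d).

Let alpha_gt0 : 0 < alpha.
Proof. by case/andP: alpha_bounds => a _; lra. Qed.

Let y i := warp alpha^-1 (Y i).
Let y0 := warp alpha^-1 z.
Let Dy i : D (y i). Proof. exact: cylinder_warp. Qed.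
Let Dy0 : D y0. Proof. exact: cylinder_warp. Qed.
Let phi0 : 0 < phi y0. Proof. exact: nbhs_singleton phi_pos. Qed.
Let u_pos i : \forall y' \near warp alpha^-1 (Y i), 0 < u y'.
Proof.
have : \forall y' \near y i, D y' by exact: (open_nbhs_nbhs (conj (open_cylinder oO) (Dy i))).
by apply: filterS => y' /u_gt0.
Qed.

Let line0 (a d : 'rV[R]_n * R) (c : R) : a + (c * 0) *: d = a.
Proof. by rewrite mulr0 scale0r addr0. Qed.

Let touch_eq0 (c : 'I_m -> R) d (C : R) :
  \sum_i w i * V (Y i + (c i * 0) *: d) = P (z + (C * 0) *: d).
Proof. by rewrite line0 -touch_eq; apply: eq_bigr => i _; rewrite line0. Qed.

Let indicator_sum i : \sum_j w j * (j == i)%:R = w i.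
Proof.
by rewrite -[RHS]mulr1 -(sum_indicator w (fun=> 1) i); apply: eq_bigr => j _; rewrite mul1r.
Qed.

Lemma touching_space_gradient i k :
  phi y0 `^ (p - 1) * dx k phi y0 = u (y i) `^ (p - 1) * dx k u (y i).
Proof.
(* Only Y_i moves, so the average moves at speed w_i; this factor appears on both sides and is
   cancelled at the end. *)
pose c (j : 'I_m) : R := (j == i)%:R.
have D1 := @gap_first_test R m w (fun h => P (z + ((\sum_j w j * c j) * h) *: space_dir k)) _
  (fun j h => V (Y j + (c j * h) *: space_dir k)) _
  (warped_space_derive p oO phi_C21 Dz phi_pos (\sum_j w j * c j) k)
  (fun j => warped_space_derive p oO u_C21 (DY j) (u_pos j) (c j) k)
  (touch_eq0 c (space_dir k) (\sum_j w j * c j)) (touch_le c (space_dir k)).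
rewrite !line0 indicator_sum in D1.
have E : \sum_j w j * (p * u (y j) `^ (p - 1) * dx k u (y j) * (j == i)%:R) =
    p * phi y0 `^ (p - 1) * (w i * dx k phi y0).
  rewrite -D1; apply: eq_bigr => j _; rewrite line0 -/(y j) /c; ring.
rewrite sum_indicator in E.
apply: (mulfI (_ : p * w i != 0)); first by rewrite mulf_neq0 // gt_eqF.
by move: E => /esym; rewrite -!mulrA => E; rewrite [w i * _]mulrCA E; ring.
Qed.

Lemma touching_time_derivative i :
  phi y0 `^ (p - 1) * dt phi y0 * z.2 `^ (alpha^-1 - 1) =
  u (y i) `^ (p - 1) * dt u (y i) * (Y i).2 `^ (alpha^-1 - 1).
Proof.
pose c (j : 'I_m) : R := (j == i)%:R.
have D1 := @gap_first_test R m w (fun h => P (z + ((\sum_j w j * c j) * h) *: time_dir)) _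
  (fun j h => V (Y j + (c j * h) *: time_dir)) _
  (warped_time_derive p oO phi_C21 Dz phi_pos (\sum_j w j * c j) alpha_gt0)
  (fun j => warped_time_derive p oO u_C21 (DY j) (u_pos j) (c j) alpha_gt0)
  (touch_eq0 c time_dir (\sum_j w j * c j)) (touch_le c time_dir).
rewrite !line0 indicator_sum mulr0 addr0 in D1.
have E : \sum_j w j * (p * u (y j) `^ (p - 1) * dt u (y j) *
      (alpha^-1 * (Y j).2 `^ (alpha^-1 - 1)) * (j == i)%:R) =
    p * phi y0 `^ (p - 1) * (dt phi y0 * (alpha^-1 * z.2 `^ (alpha^-1 - 1) * w i)).
  rewrite -D1; apply: eq_bigr => j _; rewrite line0 -/(y j) mulr0 addr0 /c; ring.
rewrite sum_indicator in E.
apply: (mulfI (_ : p * w i * alpha^-1 != 0)).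
  by rewrite !mulf_neq0 ?invr_eq0 // gt_eqF.
have -> : p * w i * alpha^-1 * (phi y0 `^ (p - 1) * dt phi y0 * z.2 `^ (alpha^-1 - 1)) =
  p * phi y0 `^ (p - 1) * (dt phi y0 * (alpha^-1 * z.2 `^ (alpha^-1 - 1) * w i)) by ring.
by rewrite -E; ring.
Qed.

Lemma touching_second_derivative (c : 'I_m -> R) k : \sum_i w i * c i = 1 ->
  \sum_i w i * (u (y i) `^ (p - 1) * (c i ^+ 2 * dx k (dx k u) (y i)) +
      (p - 1) * (u (y i) `^ (p - 1 - 1)) * (c i * dx k u (y i)) ^+ 2) <=
    phi y0 `^ (p - 1) * dx k (dx k phi) y0 + (p - 1) * phi y0 `^ (p - 1 - 1) * dx k phi y0 ^+ 2.
Proof.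
move=> c1.
have D2 := @gap_second_test R m w (fun h => P (z + ((\sum_j w j * c j) * h) *: space_dir k)) _
  (fun j h => V (Y j + (c j * h) *: space_dir k)) _ _ _
  (warped_space_derive p oO phi_C21 Dz phi_pos (\sum_j w j * c j) k)
  (fun j => warped_space_derive p oO u_C21 (DY j) (u_pos j) (c j) k)
  (warped_space_derive2 p phi_C21 Dz phi_pos (\sum_j w j * c j) k)
  (fun j => warped_space_derive2 p u_C21 (DY j) (u_pos j) (c j) k)
  (touch_eq0 c (space_dir k) (\sum_j w j * c j)) (touch_le c (space_dir k)).
rewrite c1 expr1n !mul1r in D2.
rewrite -(ler_pM2l p_gt0) mulr_sumr; apply: le_trans D2.
rewrite le_eqVlt; apply/orP; left; apply/eqP; apply: eq_bigr => i _.
by rewrite -/(y i); ring.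
Qed.

Let powR_pred (v : R) : 0 < v -> v `^ (p - 1 - 1) = v `^ (p - 1) / v.
Proof. by move=> v0; rewrite powRB ?powRr1 ?ltW // (gt_eqF v0) implybT. Qed.

Let convex_source_domain : convex_set (D `*` [set v : R | 0 < v]).
Proof.
apply: convex_setP_inv => -[[x1 t1] v1] [[x2 t2] v2] a b.
move=> [/= [/= Ox1 t10] v10] [/= [/= Ox2 t20] v20] a0 b0 ab.
have pos (r s : R) : 0 < r -> 0 < s -> 0 < a * r + b * s.
  move=> r0 s0; have [a00|an0] := eqVneq a 0.
    by move: ab; rewrite a00 mul0r !add0r => ->; rewrite mul1r.
  by rewrite ltr_pwDl ?mulr_gt0 ?mulr_ge0 ?(ltW s0) // lt_neqAle eq_sym an0.
by split=> /=; [split => /=; [exact: convex_setP|exact: pos]|exact: pos].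
Qed.

Lemma touching_subsolution : dt phi y0 <= rhs f phi y0.
Proof.
(* The vector frozen in (iii) is the common value of v^(p-1) grad v, so that dividing it by v^(p-1)
   recovers the gradient of u at each y_i and that of phi at the contact point. *)
set theta := phi y0 `^ (p - 1) *: gradient phi y0.
have Vpos i : 0 < V (Y i) := powR_gt0 p (u_gt0 (Dy i)).
have J := @concave_on_sum R _ _ _ m w (fun i => (Y i, V (Y i)))
  convex_source_domain (f_concave theta) (fun i => ltW (w_gt0 i)) w_sum
  (fun i => conj (DY i) (Vpos i)).
have combE : \sum_i w i *: (Y i, V (Y i)) = (z, P z).
  rewrite [LHS]surjective_pairing (raddf_sum (@fst ('rV[R]_n * R)%type R)).
  rewrite (raddf_sum (@snd ('rV[R]_n * R)%type R)) /=; congr pair; first exact: Yz.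
  exact: touch_eq.
rewrite combE (transformed_sourceE f alpha theta z phi0 p_gt0) in J.
have gradE i : (u (y i) `^ (p - 1))^-1 *: theta = gradient u (y i).
  rewrite /theta scalerA; apply/rowP => k; rewrite !mxE -mulrA (touching_space_gradient i k).
  by rewrite mulrA mulVf ?mul1r // gt_eqF // powR_gt0 //; exact: u_gt0 (Dy i).
have grad0 : (phi y0 `^ (p - 1))^-1 *: theta = gradient phi y0.
  by rewrite /theta scalerA mulVf ?scale1r // gt_eqF // powR_gt0.
rewrite grad0 in J.
have m1 (v : R) : 0 < v -> v `^ p = v * v `^ (p - 1) by move=> v0; rewrite mulr_powRB1 // ltW.
apply: (@viscosity_algebra R n m w (fun i => u (y i)) (fun i => u (y i) `^ (p - 1))
  (fun i => V (Y i)) (fun i => (Y i).2) (fun i => dt u (y i))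
  (fun i => f (y i, u (y i), gradient u (y i)))
  (fun i k => dx k u (y i)) (fun i k => dx k (dx k u) (y i))
  (phi y0) (phi y0 `^ (p - 1)) (P z) (dt phi y0) _ (alpha^-1 - 1)
  (fun k => dx k phi y0) (fun k => dx k (dx k phi) y0) p) => //.
(* The bounds on [alpha] say that 1/alpha - 1 lies in [0,1]. *)
- case/andP: alpha_bounds => a1 a2; rewrite subr_ge0 invf_ge1 // a2 /=.
  have : alpha^-1 <= (1 / 2)^-1 by rewrite lef_pV2 // posrE divr_gt0.
  by rewrite div1r invrK; lra.
- by move=> i; exact: (DY i).2.
- by move=> i; exact: u_gt0.
- by move=> i; exact: powR_gt0 (u_gt0 (Dy i)).
- by rewrite powR_gt0.
- by move=> i; exact: m1 (u_gt0 (Dy i)).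
- exact: m1 phi0.
- by move=> i k; exact: touching_space_gradient.
- move=> i; rewrite -(touching_time_derivative i) -Yz.
  by rewrite comb_snd.
- move=> k; rewrite -(powR_pred phi0).
  (* Contact of the values is what normalises these displacements, so the average moves at unit
     speed. *)
  have c1 : \sum_i w i * (V (Y i) / P z) = 1.
    under eq_bigr do rewrite mulrA.
    by rewrite -mulr_suml touch_eq divff // gt_eqF // powR_gt0.
  have := touching_second_derivative k c1; apply: le_trans.
  rewrite le_eqVlt; apply/orP; left; apply/eqP; apply: eq_bigr => i _.
  by rewrite powR_pred // u_gt0.
- by move=> i; exact: u_eq.
- by move=> i; exact: u_monotone.
apply: le_trans J; rewrite le_eqVlt; apply/orP; left; apply/eqP.
apply: eq_bigr => i _.
by rewrite (transformed_sourceE f alpha theta (Y i) (u_gt0 (Dy i)) p_gt0) gradE.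
Qed.

End ViscosityCore.

(** * The envelope *)

Section EnvelopeSubsolution.
Context {R : realType} {n : nat}.
Variables (Omega : set 'rV[R]_n) (f : ('rV[R]_n * R) * R * 'rV[R]_n -> R).
Variables (alpha p : R) (u : 'rV[R]_n * R -> R).
Hypotheses (oO : open Omega) (bO : bounded_set Omega) (cO : convex_set Omega).
Hypotheses (p_gt0 : 0 < p) (alpha_bounds : 1 / 2 <= alpha <= 1).
Hypothesis u_solution : classical_solution Omega f u.
Hypothesis u_boundary : forall z, cylinder_boundary Omega z -> u z = 0.
Hypothesis u_monotone : forall z, cylinder Omega z -> 0 <= dt u z.
Hypothesis u_growth : forall x y : 'rV[R]_n, closure Omega x -> Omega y ->
  (u (x + rho *: unit_direction x y, rho `^ alpha^-1)) `^ p / rho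
    @[rho --> 0^'+] --> +oo.
Hypothesis f_concave : forall theta : 'rV[R]_n,
  concave_on (cylinder Omega `*` [set v : R | 0 < v]) (transformed_source f alpha p theta).
Variable w : 'I_n.+1 -> R.
Hypothesis w_simplex : open_simplex n.+1 w.

Local Notation K := (closed_cylinder Omega).
Local Notation D := (cylinder Omega).
Local Notation V := (warped u alpha p).
Local Notation env z := (fine (lambda_envelope Omega alpha p u w z)).

Let alpha_gt0 : 0 < alpha.
Proof. by case/andP: alpha_bounds => a _; lra. Qed.
Let w_gt0 i : 0 < w i. Proof. by have /andP[] := w_simplex.1 i. Qed.
Let w_sum : \sum_i w i = 1 := w_simplex.2.
Let u_C21 : C21 D u. Proof. by case: u_solution. Qed.
Let u_cont : {within K, continuous u}. Proof. by case: u_solution. Qed.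
Let u_ge0 z (Kz : K z) : 0 <= u z := solution_ge0 u_cont u_C21 u_boundary u_monotone Kz.
Let u_gt0 z (Dz : D z) : 0 < u z :=
  solution_gt0 alpha_gt0 p_gt0 u_cont u_C21 u_boundary u_monotone u_growth Dz.
Let spec := envelope_spec bO alpha_gt0 p_gt0 u_cont u_ge0 w_simplex.

Lemma envelope_fin_num z : K z -> lambda_envelope Omega alpha p u w z \is a fin_num.
Proof. by move=> /spec[Y [_ _ _ ->]]. Qed.

Lemma envelope_ge0 z : K z -> 0 <= env z.
Proof. by move=> /spec[Y [_ _ _ ->]]; exact: powR_ge0. Qed.

Lemma envelope_maximizer z : D z -> exists Y : 'I_n.+1 -> 'rV[R]_n * R,
  [/\ forall i, D (Y i), \sum_i w i *: Y i = warp alpha z &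
   env z = (\sum_i w i * V (Y i)) `^ p^-1].
Proof.
move=> Dz; have [Y [KY Yz maxY envz]] := spec (cylinderW Dz).
exists Y; split=> //; last by rewrite envz.
apply: (maximizer_interior oO w_gt0 w_sum (V := V) _ _ _ _ (cylinder_warp alpha Dz) KY Yz maxY).
- exact: warped_boundary.
- exact: (warped_gt0 alpha_gt0 p_gt0 u_cont u_C21 u_boundary u_monotone u_growth).
- exact: (warped_lipschitz_ray oO alpha_gt0 p_gt0 u_cont u_C21 u_boundary u_monotone u_growth).
- exact: (warped_growth cO alpha_gt0 p_gt0 u_cont u_C21 u_boundary u_monotone u_growth).
Qed.

Lemma envelope_lower z (Y : 'I_n.+1 -> 'rV[R]_n * R) : K z -> (forall i, K (Y i)) ->
  \sum_i w i *: Y i = warp alpha z -> (\sum_i w i * V (Y i)) `^ p^-1 <= env z.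
Proof.
move=> Kz KY Yz; have [Y' [_ _ maxY ->]] := spec Kz.
apply: ler_powRl; [by rewrite invr_ge0 ltW| |exact: maxY].
by rewrite sumr_ge0 // => i _; rewrite mulr_ge0 ?powR_ge0 // ltW.
Qed.

Lemma solution_le_envelope z : K z -> u z <= env z.
Proof.
move=> Kz.
have wz : \sum_i w i *: warp alpha z = warp alpha z by rewrite -scaler_suml w_sum scale1r.
have := envelope_lower Kz (fun=> closed_cylinder_warp alpha Kz) wz.
rewrite -mulr_suml w_sum mul1r /warped warpKV ?gt_eqF //; last exact: Kz.2.
by rewrite powRK; [|rewrite gt_eqF|exact: u_ge0].
Qed.

Let near_warp (z : 'rV[R]_n * R) (Q : set ('rV[R]_n * R)) a : 0 < a -> D z ->
  (\forall y \near warp a z, Q y) -> \forall y \near z, D y /\ Q (warp a y).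
Proof.
move=> a0 Dz HQ.
have /subspace_continuousP /(_ z (cylinderW Dz)) wc := @warp_continuous _ _ Omega a a0.
have nD : nbhs z D := open_nbhs_nbhs (conj (open_cylinder oO) Dz).
have H := wc _ HQ.
exact: (@filterS2 _ (nbhs z) (nbhs_filter z) _ _ _
  (fun y (h1 : D y) h2 => conj h1 (h2 (cylinderW h1))) nD H).
Qed.

Lemma envelope_viscosity_subsolution : viscosity_subsolution Omega f (fun z => env z).
Proof.
split=> [z Dz a za|z phi Dz phi_C21 phiz le_phi].
  have H := envelope_usc bO alpha_gt0 p_gt0 u_cont u_ge0 w_simplex (cylinderW Dz) za.
  have nD : nbhs z D := open_nbhs_nbhs (conj (open_cylinder oO) Dz).
  exact: (@filterS2 _ (nbhs z) (nbhs_filter z) _ _ _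
    (fun y (h1 : D y) h2 => h2 (cylinderW h1)) nD H).
have [Y [DY Yz envz]] := envelope_maximizer Dz.
have Dwz := cylinder_warp alpha Dz.
have wz : warp alpha^-1 (warp alpha z) = z.
  by apply: warpKV; [rewrite gt_eqF|exact: ltW Dz.2].
(* The envelope dominates u, which is positive inside; hence phi^p is differentiable near the
   contact point. *)
have phi0 : 0 < phi z.
  by rewrite phiz (lt_le_trans (u_gt0 Dz)) // solution_le_envelope //; exact: cylinderW.
have phi_pos : \forall y \near z, 0 < phi y.
  have [phi_cont _ _ _] := phi_C21.
  rewrite continuous_open_subspace in phi_cont; last exact: open_cylinder.
  exact: (@cvgr_gt _ _ _ (nbhs_filter z) _ _ (phi_cont z (mem_set Dz)) 0 phi0).
have sum0 (Y' : 'I_n.+1 -> 'rV[R]_n * R) : 0 <= \sum_i w i * V (Y' i).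
  by rewrite sumr_ge0 // => i _; rewrite mulr_ge0 ?powR_ge0 // ltW.
have sumpK (Y' : 'I_n.+1 -> 'rV[R]_n * R) : ((\sum_i w i * V (Y' i)) `^ p^-1) `^ p = \sum_i w i * V (Y' i).
  by apply: powRVK; [rewrite gt_eqF|exact: sum0].
rewrite -wz.
apply: (touching_subsolution oO cO alpha_bounds p_gt0 u_C21 phi_C21 u_gt0 _ u_monotone
  f_concave w_gt0 w_sum (ltn0Sn n) Dwz DY Yz).
- by case: u_solution.
- by rewrite wz.
- by rewrite /warped wz phiz envz sumpK.
move=> c d.
have nDY : forall i, \forall h \near (0 : R), D (Y i + (c i * h) *: d).
  by move=> i; exact: (line_cvg d (c i) (open_nbhs_nbhs (conj (open_cylinder oO) (DY i)))).
have nDYs := @filter_forall _ _ (fun i (h : R) => D (Y i + (c i * h) *: d)) _ (nbhs_filter (0 : R)) nDY.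
have nz : \forall h \near (0 : R), D (warp alpha z + ((\sum_i w i * c i) * h) *: d) /\
    env (warp alpha^-1 (warp alpha z + ((\sum_i w i * c i) * h) *: d)) <=
    phi (warp alpha^-1 (warp alpha z + ((\sum_i w i * c i) * h) *: d)).
  have H := @near_warp (warp alpha z) (fun y => env y <= phi y) alpha^-1.
  rewrite wz invr_gt0 in H.
  exact: (line_cvg d (\sum_i w i * c i) (H alpha_gt0 Dwz le_phi)).
apply: (@filterS2 _ (nbhs (0 : R)) (nbhs_filter (0 : R)) _ _ _ _ nDYs nz).
move=> h DYh [Dzh le_h].
set zh := warp alpha z + ((\sum_i w i * c i) * h) *: d in Dzh le_h *.
(* The displaced maximizer is a competitor at the displaced average [zh], so its value is below the
   envelope there, and hence below phi. *)
have Yzh : \sum_i w i *: (Y i + (c i * h) *: d) = warp alpha (warp alpha^-1 zh).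
  rewrite warpVK ?gt_eqF //; last exact: ltW Dzh.2.
  under eq_bigr do rewrite scalerDr scalerA mulrA.
  by rewrite big_split /= Yz -scaler_suml -mulr_suml.
have Kzh : K (warp alpha^-1 zh) by apply: cylinderW; exact: cylinder_warp.
have := envelope_lower Kzh (fun i => cylinderW (DYh i)) Yzh.
move=> /le_trans/(_ le_h) /(ler_powRl (ltW p_gt0) (powR_ge0 _ _)).
by rewrite sumpK.
Qed.

(** Near an interior point all components of the maximizer are shifted by the same vector; they stay
    in the open cylinder, and since the weights sum to 1 the average shifts by that vector too. At a
    boundary point the envelope is 0, so a is negative and nonnegativity suffices. *)
Lemma envelope_lsc (z : 'rV[R]_n * R) (a : R) : K z -> a < env z ->
  \forall y \near within K (nbhs z), a < env y.
Proof.
move=> Kz az; have [a0|a0] := ltP a 0.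
  by apply: (@filterS _ (nbhs z) (nbhs_filter z) setT); [move=> y _ /envelope_ge0; exact: lt_le_trans|exact: filterT].
have [bz|Dz] := closed_cylinder_dichotomy oO Kz.
  by move: az; rewrite (envelope_boundary oO bO cO alpha_gt0 p_gt0 u_cont u_ge0 u_boundary w_simplex bz) /= ltNge a0.
have [Y [DY Yz envz]] := envelope_maximizer Dz.
have /subspace_continuousP /(_ z Kz) wc := @warp_continuous _ _ Omega alpha alpha_gt0.
have Vc x : D x -> V x' @[x' --> x] --> V x.
  move=> Dx; have : {within D, continuous V}.
    apply: continuous_subspaceW (warped_continuous alpha_gt0 p_gt0 u_cont u_ge0).
    exact: cylinderW.
  by rewrite continuous_open_subspace; [move/(_ x (mem_set Dx))|exact: open_cylinder].
set c := warp alpha z.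
have shift_cvg (y : 'rV[R]_n * R) : y + (x - c) @[x --> c] --> y.
  rewrite -[X in _ --> X]addr0 -(subrr c).
  by apply: cvgD; [exact: cvg_cst|apply: cvgB; [exact: cvg_id|exact: cvg_cst]].
have Gc : \sum_i w i * V (Y i + (x - c)) @[x --> c] --> \sum_i w i * V (Y i).
  apply: (cvg_big add_continuous) => i _; apply: cvgMl_tmp.
  exact: (@cvg_comp _ _ _ (fun x => Y i + (x - c)) V _ _ _ (shift_cvg (Y i)) (Vc _ (DY i))).
have sum0 (Y' : 'I_n.+1 -> 'rV[R]_n * R) : 0 <= \sum_i w i * V (Y' i).
  by rewrite sumr_ge0 // => i _; rewrite mulr_ge0 ?powR_ge0 // ltW.
have p0 : p != 0 by rewrite gt_eqF.
have aG : a `^ p < \sum_i w i * V (Y i).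
  rewrite -(powRVK p0 (sum0 Y)) -envz.
  by apply: gt0_ltr_powR az; rewrite // nnegrE // envelope_ge0.
have nG := @cvgr_gt _ _ _ (nbhs_filter c) _ _ Gc _ aG.
have nD : forall i, \forall x \near c, D (Y i + (x - c)).
  by move=> i; exact: (shift_cvg (Y i) _ (open_nbhs_nbhs (conj (open_cylinder oO) (DY i)))).
have nDs := @filter_forall _ _ (fun i x => D (Y i + (x - c))) _ (nbhs_filter c) nD.
pose Q := [set x | (forall i, D (Y i + (x - c))) /\ a `^ p < \sum_i w i * V (Y i + (x - c))].
have nQ : nbhs c Q by exact: filterI nDs nG.
have H := wc Q nQ.
apply: (@filterS _ (nbhs z) (nbhs_filter z) _ _ _ H) => y Hy Ky.
have [DYy Gy] := Hy Ky.
have Yy : \sum_i w i *: (Y i + (warp alpha y - warp alpha z)) = warp alpha y.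
  under eq_bigr do rewrite scalerDr.
  by rewrite big_split /= Yz -scaler_suml w_sum scale1r addrC subrK.
apply: lt_le_trans (envelope_lower Ky (fun i => cylinderW (DYy i)) Yy).
rewrite -(powRK p0 a0).
by apply: gt0_ltr_powR Gy; [rewrite invr_gt0|rewrite nnegrE powR_ge0|rewrite nnegrE sum0].
Qed.

Lemma envelope_continuous : {within K, continuous (fun z => env z)}.
Proof.
apply/subspace_continuousP => z Kz; apply/cvgrPdist_lt => e e0.
have H1 := @envelope_usc _ _ Omega alpha p u bO alpha_gt0 p_gt0 u_cont u_ge0 w w_simplex z (env z + e) Kz.
have H2 := @envelope_lsc z (env z - e) Kz.
rewrite ltrDl in H1; rewrite ltrBlDr ltrDl in H2.
apply: (@filterS2 _ _ (within_filter _ (nbhs_filter z)) _ _ _ _ (H1 e0) (H2 e0)) => y y1 y2.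
by rewrite ltr_distlC; apply/andP; split; [exact: y2|exact: y1].
Qed.

Lemma envelope_eq_solution : weak_comparison_principle Omega f ->
  forall z, K z -> lambda_envelope Omega alpha p u w z = (u z)%:E.
Proof.
move=> wcp z Kz; rewrite -[LHS]fineK ?envelope_fin_num //; congr EFin.
apply/eqP; rewrite eq_le solution_le_envelope // andbT.
apply: (wcp u (fun z => env z)) => //.
- exact: envelope_continuous.
- exact: envelope_ge0.
- exact: envelope_viscosity_subsolution.
- move=> y yb; rewrite u_boundary //.
  by rewrite (envelope_boundary oO bO cO alpha_gt0 p_gt0 u_cont u_ge0 u_boundary w_simplex yb).
Qed.

End EnvelopeSubsolution.

Theorem theorem3p1 (R : realType) (n : nat) (Omega : set 'rV[R]_n)
    (f : ('rV[R]_n * R) * R * 'rV[R]_n -> R) (p alpha : R)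
    (u : 'rV[R]_n * R -> R)
    (n_ge1 : (1 <= n)%N)
    (Omega_domain : domain Omega)
    (Omega_bounded : bounded_set Omega)
    (Omega_convex : convex_set Omega)
    (f_continuous :
      {within cylinder Omega `*` [set: R] `*` [set: 'rV[R]_n], continuous f})
    (f_ge0 : forall z v theta, cylinder Omega z -> 0 <= f (z, v, theta))
    (p_bounds : 0 < p < 1)
    (alpha_bounds : 1 / 2 <= alpha <= 1)
    (u_solution : classical_solution Omega f u)
    (u_boundary : forall z, cylinder_boundary Omega z -> u z = 0)
    (u_monotone : forall z, cylinder Omega z -> 0 <= dt u z)
    (u_growth : forall x y : 'rV[R]_n, closure Omega x -> Omega y ->
      (u (x + rho *: unit_direction x y, rho `^ alpha^-1)) `^ p / rho
        @[rho --> 0^'+] --> +oo)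
    (f_concave : forall theta : 'rV[R]_n,
      concave_on (cylinder Omega `*` [set v : R | 0 < v])
        (transformed_source f alpha p theta)) :
  (forall lambda : 'I_n.+1 -> R, open_simplex n.+1 lambda ->
    [/\ forall z, closed_cylinder Omega z ->
          lambda_envelope Omega alpha p u lambda z \is a fin_num,
        viscosity_subsolution Omega f
          (fun z => fine (lambda_envelope Omega alpha p u lambda z)) &
        forall z, cylinder_boundary Omega z ->
          lambda_envelope Omega alpha p u lambda z = 0%E]) /\
  (weak_comparison_principle Omega f ->
    (forall z, closed_cylinder Omega z ->
      envelope Omega alpha p u z = (u z)%:E) /\
    parabolically_concave Omega alpha p u).
Proof.
have [oO _ _] := Omega_domain.
have /andP[p_gt0 _] := p_bounds.
have alpha_gt0 : 0 < alpha by case/andP: alpha_bounds => a _; lra.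
have [u_C21 u_cont _] := u_solution.
have u_ge0 z (Kz : closed_cylinder Omega z) : 0 <= u z.
  exact: (solution_ge0 u_cont u_C21 u_boundary u_monotone Kz).
split=> [w w_simplex|wcp].
  split.
  - exact: (envelope_fin_num Omega_bounded p_gt0 alpha_bounds u_solution u_boundary u_monotone w_simplex).
  - exact: (envelope_viscosity_subsolution oO Omega_bounded Omega_convex p_gt0 alpha_bounds
      u_solution u_boundary u_monotone u_growth f_concave w_simplex).
  - exact: (envelope_boundary oO Omega_bounded Omega_convex alpha_gt0 p_gt0 u_cont u_ge0 u_boundary w_simplex).
have envE w (w_simplex : open_simplex n.+1 w) z (Kz : closed_cylinder Omega z) :
    lambda_envelope Omega alpha p u w z = (u z)%:E.
  exact: (envelope_eq_solution oO Omega_bounded Omega_convex p_gt0 alpha_bounds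
    u_solution u_boundary u_monotone u_growth f_concave w_simplex wcp Kz).
(* The weights [1 - l, l / n, ..., l / n] lie in the open simplex as [n >= 1]. *)
have n0 : 0 < n%:R :> R by rewrite ltr0n.
pose w l (i : 'I_n.+1) : R := if i == ord0 then 1 - l else l / n%:R.
have w_sum (l : R) (W : lmodType R) (a b : W) :
    \sum_i w l i *: (if i == ord0 then a else b) = (1 - l) *: a + l *: b.
  rewrite big_ord_recl /w eqxx; congr (_ + _).
  rewrite (eq_bigr (fun=> (l / n%:R) *: b)) => [|i _]; last by [].
  rewrite sumr_const card_ord -scaler_nat scalerA mulrCA mulfV ?mulr1 //.
  by rewrite gt_eqF.
have w_sumR (l a b : R) :
    \sum_i w l i * (if i == ord0 then a else b) = (1 - l) * a + l * b.
  exact: (w_sum l R^o a b).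
have w_simplex l : 0 < l < 1 -> open_simplex n.+1 (w l).
  move=> /andP[l0 l1]; split.
    move=> i; rewrite /w; case: ifP => _.
      by rewrite subr_gt0 l1 ltrBlDr ltrDl.
    rewrite divr_gt0 //= ltr_pdivrMr // mul1r (lt_le_trans l1) //.
    by rewrite ler1n.
  have := w_sumR l 1 1; rewrite !mulr1 subrK => <-; apply: eq_bigr => i _.
  by rewrite if_same mulr1.
split.
  move=> z Kz; apply/eqP; rewrite eq_le; apply/andP; split.
    by apply: ge_ereal_sup => _ [v v_simplex <-]; rewrite envE.
  (* Every lambda-envelope equals u, so one admissible weight vector gives the lower bound; 1/2 is
     an arbitrary choice. *)
  have half : 0 < (2^-1 : R) < 1 by rewrite invr_gt0 ltr0n invf_lt1 // ltr1n.
  apply: ereal_sup_ubound; exists (w 2^-1); first exact: (w_simplex _ half).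
  exact: (envE _ (w_simplex _ half) z Kz).
split=> // z1 z2 l K1 K2 l01.
have Kl : closed_cylinder Omega
    ((1 - l) *: z1.1 + l *: z2.1, power_mean2 alpha l z1.2 z2.2).
  case/andP: l01 => l0 l1; split => /=; last exact: powR_ge0.
  apply: (convex_setP (convex_closure Omega_convex)); rewrite ?subrK //.
  - exact: K1.1.
  - exact: K2.1.
  - by rewrite subr_ge0 ltW.
  - exact: ltW.
(* With u rewritten as the envelope for the weights [w l], concavity only says that the tuple (z1,
   z2, ..., z2) is a competitor in the supremum. *)
rewrite -lee_fin -(envE _ (w_simplex l l01) _ Kl).
have w_mean (q : R) (g : 'rV[R]_n * R -> R) :
    power_mean q (w l) (fun i => g (if i == ord0 then z1 else z2)) = power_mean2 q l (g z1) (g z2).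
  rewrite /power_mean /power_mean2; congr (_ `^ _).
  rewrite -(w_sumR l (g z1 `^ q) (g z2 `^ q)); apply: eq_bigr => i _.
  by case: ifP.
apply: ereal_sup_ubound; exists (fun i : 'I_n.+1 => if i == ord0 then z1 else z2).
  split => /=.
  - by move=> i; case: ifP.
  - by rewrite -w_sum; apply: eq_bigr => i _; case: ifP.
  - by rewrite (w_mean alpha snd).
by rewrite (w_mean p u).
Qed.
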